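(* Let $U,V,W\subset\mathbb{C}$ be nonempty compact sets. An operator $B_+\in \Psi E_+(U,V,W)$ is invertible if and only if all operators $C_+\in M_+(U,V,W)$ are invertible. In other words, for all $B_+\in\Psi E_+(U,V,W)$, $$\operatorname{spec} B_+\ =\ \bigcup_{C_+\in M_+(U,V,W)}\operatorname{spec} C_+ .$$
   Context: $\mathbb{N}=\{1,2,\dots\}$. $M_+(U,V,W)$ is the set of semi-infinite tridiagonal matrices $(a_{ij})_{i,j\in\mathbb{N}}$ with subdiagonal entries $a_{i,i-1}\in U$, diagonal entries $a_{i,i}\in V$, superdiagonal entries $a_{i,i+1}\in W$, all other entries zero. $M_n(U,V,W)$ is the set of $n\times n$ matrices of the same kind. Matrices in $M_+(U,V,W)$ act as bounded operators on $\ell^p(\mathbb{N})$, where $p\in[1,\infty]$; their invertibility and spectrum do not depend on $p$. $A_+\in M_+(U,V,W)$ is pseudoergodic, $A_+\in \Psi E_+(U,V,W)$, if for every $n\in\mathbb N$, every $B\in M_n(U,V,W)$ and every $\varepsilon>0$ there is a submatrix $C$ of $A_+$ composed of rows and columns $k+1,\dots,k+n$ of $A_+$, for some integer $k\ge 0$, with $\|B-C\|<\varepsilon$. *)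

(* Defs.v *)
From HB Require Import structures.
From mathcomp Require Import all_boot all_order all_algebra.
From mathcomp Require Import all_classical all_reals all_analysis.
From mathcomp Require Import complex.

Set Implicit Arguments.
Unset Strict Implicit.
Unset Printing Implicit Defensive.

Import Order.TTheory GRing.Theory Num.Theory numFieldNormedType.Exports.
Import ComplexField.Normc.

Local Open Scope classical_set_scope.
Local Open Scope ring_scope.

(* Sequences and semi-infinite matrices are indexed by nat = {0, 1, ...}, i.e.
   index n stands for n + 1 in {1, 2, ...}. *)

Section Tridiagonal.
Variable R : realType.
Implicit Types U V W : set R[i].

Definition tridiag_entry U V W (i j : nat) : set R[i] :=
  if i == j.+1 then U
  else if i == j then V
  else if j == i.+1 then W
  else [set 0].

(* M_+(U, V, W) *)
Definition Mplus U V W : set (nat -> nat -> R[i]) :=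
  [set A | forall i j, tridiag_entry U V W i j (A i j)].

(* M_n(U, V, W) *)
Definition Mfin U V W n : set 'M[R[i]]_n :=
  [set B | forall i j : 'I_n, tridiag_entry U V W i j (B i j)].

Definition diag_submx (A : nat -> nat -> R[i]) (k n : nat) : 'M[R[i]]_n :=
  \matrix_(i < n, j < n) A (k + i)%N (k + j)%N.

(* Psi E_+(U, V, W).  The norm of MathComp-Analysis on 'M_n is the maximum of
   the moduli of the entries; as n is fixed before the tolerance eps, any other
   norm on 'M_n, such as an operator norm, gives the same set. *)
Definition PsiEplus U V W : set (nat -> nat -> R[i]) :=
  [set A | Mplus U V W A /\
    forall (n : nat) (B : 'M[R[i]]_n) (eps : R),
      (0 < n)%N -> Mfin U V W B -> 0 < eps ->
      exists k : nat, `|B - diag_submx A k n| < (eps%:C)%C].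

(* The product A x of a tridiagonal matrix A and a sequence x: all entries A i j with i.+1 < j
   vanish, so the (finite) sum stops at j = i.+1. *)
Definition tridiag_act (A : nat -> nat -> R[i]) (x : nat -> R[i]) : nat -> R[i] :=
  fun i => \sum_(j < i.+2) A i j * x j.

End Tridiagonal.

Section LpOperators.
Variables (R : realType) (p : \bar R).
Implicit Types (x y : nat -> R[i]) (S T : (nat -> R[i]) -> nat -> R[i]).

Definition lp_norm x : \bar R :=
  ('N[counting]_p [EFin \o (@normc R \o x)])%E.

Definition lp : set (nat -> R[i]) := [set x | (lp_norm x < +oo)%E].

(* Operators are functions on all sequences; only their restriction to l^p
   matters. *)
Definition lp_bounded_operator T : Prop :=
  [/\ forall x, lp x -> lp (T x),
      forall (a : R[i]) x y, lp x -> lp y ->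
        T (fun n => a * x n + y n) = (fun n => a * T x n + T y n)
    & exists M : R, forall x, lp x -> (lp_norm (T x) <= M%:E * lp_norm x)%E].

Definition lp_invertible T : Prop :=
  lp_bounded_operator T /\
  exists S, lp_bounded_operator S /\
    forall x, lp x -> S (T x) = x /\ T (S x) = x.

Definition lp_spec T : set R[i] :=
  [set z | ~ lp_invertible (fun x n => T x n - z * x n)].

End LpOperators.

(* Main.v *)
(** A lp-bounded inverse of a tridiagonal matrix has exponentially decaying
    entries (conjugate by slowly varying exponential weights), and conversely an
    inverse matrix with such entries is an inverse on every l^p.  So
    invertibility means "has a decaying inverse matrix", which depends neither
    on p nor on transposition.

    Let [B] be pseudoergodic with decaying inverse [S].  Limits of recentred
    copies of [S] along an ultrafilter show that every bi-infinite [A] in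
    M(U, V, W) has a decaying inverse.  Given [C] in M_+(U, V, W), let [A] carry
    the reflection of [C^T] on the negative half-axis and [B] on the other one.
    Eliminating the block [B] shows that the corner [M] of [A^-1] inverts a
    rank-one modification of [C^T].  By the Sherman-Morrison formula either
    [C^T] has a decaying inverse, or the first column and the first row of [M]
    are nonzero decaying vectors [x], [y] with [C^T x = 0] and [C y = 0].  In
    the second case, multiples of [x] and [y], separated by a single zero, form
    a null vector of another bi-infinite matrix in M(U, V, W), which is
    invertible: contradiction. *)

Require Import Defs.
From HB Require Import structures.
From mathcomp Require Import all_boot all_order all_algebra.
From mathcomp Require Import all_classical all_reals all_analysis.
From mathcomp Require Import complex finmap ess_sup_inf.
From mathcomp Require Import zify ring lra.

Set Implicit Arguments.
Unset Strict Implicit.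
Unset Printing Implicit Defensive.

Import Order.TTheory GRing.Theory Num.Theory numFieldNormedType.Exports.
Import ComplexField.Normc.

Local Open Scope classical_set_scope.
Local Open Scope ring_scope.

#[local] Arguments normc : simpl never.

(** * The real-valued modulus of complex numbers *)

Section ComplexModulus.
Variable R : realType.
Implicit Types x y : R[i].

Lemma normc_ge0 x : 0 <= normc x.
Proof. by case: x => a b; exact: sqrtr_ge0. Qed.

Lemma normc_triangle x y : normc (x + y) <= normc x + normc y.
Proof. exact: le_normcD. Qed.

Lemma normc_sub x y : normc (x - y) = normc (y - x).
Proof. by rewrite -normcN opprB. Qed.

Lemma normc_real (a : R) : normc (a%:C)%C = `|a|.
Proof. by rewrite /normc /= expr0n addr0 sqrtr_sqr. Qed.

Lemma normc_eq0 x : (normc x == 0) = (x == 0).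
Proof. by apply/eqP/eqP => [/eq0_normc//|->]; exact: normc0. Qed.

End ComplexModulus.

(** * Bounds for the l^p norm *)

Section LpNormBounds.
Variables (R : realType) (p : \bar R).
Hypothesis hp : (1%:E <= p)%E.
Implicit Types (x y : nat -> R[i]) (M : R).

(** A real bound carries finiteness and the estimate at once, so later arguments stay in real
    arithmetic. *)
Definition lp_le x M := (lp_norm p x <= M%:E)%E.

Lemma lp_le_finP (q : R) x M : p = q%:E -> 0 <= M ->
  lp_le x M <-> forall n, \sum_(0 <= k < n) (normc (x k)) `^ q <= M `^ q.
Proof.
move=> pq M0; have q1 : 1 <= q by rewrite -lee_fin -pq.
have q0 : 0 < q by apply: lt_le_trans q1.
have E n : (\sum_(0 <= k < n) `|(EFin \o (@normc R \o x)) k| `^ q)%E =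
    (\sum_(0 <= k < n) (normc (x k)) `^ q)%:E.
  rewrite -sumEFin; apply: eq_bigr => k _ /=.
  by rewrite ger0_norm ?normc_ge0.
have S0 : (0 <= \sum_(k <oo) `|(EFin \o (@normc R \o x)) k| `^ q)%E.
  by apply: nneseries_ge0 => k _ _; exact: poweR_ge0.
have -> : lp_le x M <->
    (\sum_(k <oo) `|(EFin \o (@normc R \o x)) k| `^ q <= (M `^ q)%:E)%E.
  rewrite /lp_le /lp_norm pq Lnorm_counting//; split => H.
    have := @gt0_ler_poweR R q (ltW q0) _ _ _ _ H.
    rewrite !in_itv/= !leey !andbT poweR_ge0 lee_fin M0 => /(_ isT isT).
    by rewrite -poweRrM mulVf ?gt_eqF// poweRe1.
  have iq : 0 <= q^-1 by rewrite invr_ge0 ltW.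
  have := @gt0_ler_poweR R q^-1 iq _ _ _ _ H.
  rewrite !in_itv/= !leey !andbT S0 lee_fin powR_ge0 => /(_ isT isT).
  by rewrite -powRrM mulfV ?gt_eqF// powRr1.
split => H.
  move=> n; rewrite -lee_fin -E; apply: le_trans H.
  by apply: nneseries_lim_ge => k _ _; exact: poweR_ge0.
apply: lime_le; first by apply: is_cvg_nneseries => k _ _; exact: poweR_ge0.
by apply: nearW => n; rewrite E lee_fin.
Qed.

(** Only the empty set is null for the counting measure, so the essential supremum is a supremum. *)
Lemma lp_le_inftyP x M : p = +oo%E -> lp_le x M <-> forall k, normc (x k) <= M.
Proof.
move=> py; rewrite /lp_le /lp_norm py unlock.
have -> : (0 < counting [set: nat])%E :> bool.
  move=> T; rewrite /counting asboolF ?ltry//; exact: infinite_nat.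
split => H.
  move=> k.
  have /ess_supP [N [mN N0 sN]] := H.
  have NE : N = set0.
    have {N0} : (if `[< finite_set N >] then (#|` fset_set N|)%:R%:E else +oo%E)
        = 0%E :> \bar R := N0.
    case: asboolP => // fN.
    move/eqP; rewrite eqe pnatr_eq0. by rewrite cardfs_eq0 => /eqP /fset_set_set0 ->.
  apply/negbNE/negP => nk.
  suff : N k by rewrite NE.
  apply: sN => /=; rewrite ger0_norm ?normc_ge0// lee_fin => Hk.
  by rewrite Hk in nk.
apply/ess_supP; apply: nearW => k /=.
by rewrite ger0_norm ?normc_ge0// lee_fin.
Qed.


Lemma lp_le_ge0 x M : lp_le x M -> 0 <= M.
Proof. by move=> H; rewrite -lee_fin; apply: le_trans H; exact: Lnorm_ge0. Qed.

Lemma le_lp_le x M M' : M <= M' -> lp_le x M -> lp_le x M'.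
Proof. by move=> MM H; apply: le_trans H _; rewrite lee_fin. Qed.

Lemma lp_exponent_cases : (exists2 q, p = q%:E & 0 < q) \/ p = +oo%E.
Proof.
case: p hp => // [q|_]; last by right.
by rewrite lee_fin => q1; left; exists q => //; exact: lt_le_trans q1.
Qed.

Lemma lp_le_trans x y M : (forall k, normc (x k) <= normc (y k)) ->
  lp_le y M -> lp_le x M.
Proof.
move=> xy yM; have M0 := lp_le_ge0 yM.
have [[q pq q0]|py] := lp_exponent_cases; last first.
  move: yM => /(lp_le_inftyP _ _ py) yM; apply/(lp_le_inftyP _ _ py) => k.
  exact: le_trans (xy k) (yM k).
move: yM => /(lp_le_finP _ pq M0) yM; apply/(lp_le_finP _ pq M0) => n.
apply: le_trans (yM n); apply: ler_sum => k _.
by apply: ge0_ler_powR; rewrite ?nnegrE ?normc_ge0// ltW.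
Qed.

(** Minkowski's inequality is applied to the moduli, whose sum dominates the modulus of the sum. *)
Lemma lp_leD x y M N : lp_le x M -> lp_le y N ->
  lp_le (fun k => x k + y k) (M + N).
Proof.
move=> xM yN.
pose f k := normc (x k); pose g k := normc (y k).
have fg : ('N[counting]_p [EFin \o (f \+ g)%R] <= (M + N)%:E)%E.
  apply: le_trans (eminkowski _ _ _ hp) _ => //.
  by rewrite EFinD; apply: leeD.
have : lp_le (fun k => (f k + g k)%:C%C) (M + N).
  apply: le_trans fg; rewrite le_eqVlt; apply/orP; left; apply/eqP.
  apply: eq_Lnorm => k /=; rewrite normc_real ger0_norm//.
  by apply: addr_ge0; exact: normc_ge0.
apply: lp_le_trans => k; rewrite normc_real ger0_norm; last first.
  by apply: addr_ge0; exact: normc_ge0.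
exact: normc_triangle.
Qed.

Lemma lp_leZ (a : R[i]) x M : lp_le x M ->
  lp_le (fun k => a * x k) (normc a * M).
Proof.
move=> xM; have M0 := lp_le_ge0 xM; have a0 := normc_ge0 a.
have aM0 : 0 <= normc a * M by apply: mulr_ge0.
have [[q pq q0]|py] := lp_exponent_cases; last first.
  move: xM => /(lp_le_inftyP _ _ py) xM; apply/(lp_le_inftyP _ _ py) => k.
  by rewrite normcM; exact: ler_wpM2l.
move: xM => /(lp_le_finP _ pq M0) xM; apply/(lp_le_finP _ pq aM0) => n.
under eq_bigr do rewrite normcM powRM ?normc_ge0//.
rewrite -mulr_sumr powRM//; apply: ler_wpM2l; first exact: powR_ge0.
exact: xM.
Qed.

Lemma lp_le_coord x M k : lp_le x M -> normc (x k) <= M.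
Proof.
move=> xM; have M0 := lp_le_ge0 xM.
have [[q pq q0]|py] := lp_exponent_cases; last by move: xM => /(lp_le_inftyP _ _ py).
move: xM => /(lp_le_finP _ pq M0)/(_ k.+1); rewrite big_nat_recr//= => H.
have {}H : normc (x k) `^ q <= M `^ q.
  by apply: le_trans H; rewrite lerDr sumr_ge0// => i _; exact: powR_ge0.
rewrite leNgt; apply/negP => Mx.
move: H; rewrite leNgt => /negP; apply; apply: gt0_ltr_powR => //.
by rewrite nnegrE normc_ge0.
Qed.

(** The norm is the supremum of the norms of finite truncations, so the comparison sequence may
    change with [n]. *)
Lemma lp_le_trunc x M : 0 <= M ->
  (forall n, exists2 y, lp_le y M & forall k, (k < n)%N -> y k = x k) ->
  lp_le x M.
Proof.
move=> M0 H; have [[q pq q0]|py] := lp_exponent_cases; last first.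
  apply/(lp_le_inftyP _ _ py) => k; have [y yM xy] := H k.+1.
  by rewrite -xy//; move: yM => /(lp_le_inftyP _ _ py).
apply/(lp_le_finP _ pq M0) => n; have [y yM xy] := H n.
move: yM => /(lp_le_finP _ pq M0)/(_ n); apply: le_trans.
by rewrite !big_mkord; apply: ler_sum => k _; rewrite xy.
Qed.

Lemma lp_le_shiftl x M : lp_le x M -> lp_le (fun k => x k.+1) M.
Proof.
move=> xM; have M0 := lp_le_ge0 xM.
have [[q pq q0]|py] := lp_exponent_cases; last first.
  by move: xM => /(lp_le_inftyP _ _ py) xM; apply/(lp_le_inftyP _ _ py) => k.
move: xM => /(lp_le_finP _ pq M0) xM; apply/(lp_le_finP _ pq M0) => n.
by apply: le_trans (xM n.+1); rewrite big_nat_recl// lerDr powR_ge0.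
Qed.

Lemma lp_le_shiftr x M : lp_le x M ->
  lp_le (fun k => if k is k'.+1 then x k' else 0) M.
Proof.
move=> xM; have M0 := lp_le_ge0 xM.
have [[q pq q0]|py] := lp_exponent_cases; last first.
  move: xM => /(lp_le_inftyP _ _ py) xM; apply/(lp_le_inftyP _ _ py) => -[|k]//.
  by rewrite normc0.
move: xM => /(lp_le_finP _ pq M0) xM; apply/(lp_le_finP _ pq M0) => -[|n].
  by rewrite big_geq// powR_ge0.
by rewrite big_nat_recl//= normc0 powR0 ?gt_eqF// add0r.
Qed.

Lemma lp_le_delta j : lp_le (fun k => (k == j)%:R) 1.
Proof.
have [[q pq q0]|py] := lp_exponent_cases; last first.
  apply/(lp_le_inftyP _ _ py) => k; case: (k == j); rewrite ?normc0 ?normc1//.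
apply/(lp_le_finP _ pq ler01) => n; rewrite powR1.
have E k : (normc ((k == j)%:R : R[i]) `^ q) = (k == j)%:R.
  by case: (k == j); rewrite ?normc0 ?normc1 ?powR1 ?powR0 ?gt_eqF.
under eq_bigr do rewrite E.
have [jn|nj] := ltnP j n; last first.
  rewrite big_nat big1 ?ler01// => i /andP[_ ilt].
  by rewrite ltn_eqF// (leq_trans ilt).
rewrite big_mkord (bigD1 (Ordinal jn))//= eqxx big1 ?addr0// => i.
by rewrite -val_eqE /= => /negbTE ->.
Qed.

Lemma lp_le_sum (I : Type) (s : seq I) (x : I -> nat -> R[i]) (M : I -> R) :
  (forall i, lp_le (x i) (M i)) ->
  lp_le (fun k => \sum_(i <- s) x i k) (\sum_(i <- s) M i).
Proof.
move=> H; elim: s => [|i s IH].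
  apply: (@lp_le_trans _ (fun k => 0 * (k == 0%N)%:R)).
    by move=> k; rewrite big_nil mul0r.
  by have := lp_leZ 0 (lp_le_delta 0); rewrite normc0 mul0r big_nil.
rewrite big_cons; apply: le_trans (lp_leD (H i) IH).
rewrite le_eqVlt; apply/orP; left; apply/eqP; apply: eq_Lnorm => k /=.
by rewrite big_cons.
Qed.

Lemma lpP x : lp p x <-> exists M, lp_le x M.
Proof.
split=> [H|[M H]]; last exact: le_lt_trans H (ltry _).
exists (fine (lp_norm p x)); rewrite /lp_le fineK// ge0_fin_numE//.
exact: Lnorm_ge0.
Qed.

Lemma lp_le_operatorP (T : (nat -> R[i]) -> nat -> R[i]) M :
  0 <= M -> (forall x m, lp_le x m -> lp_le (T x) (M * m)) ->
  forall x, lp p x -> (lp_norm p (T x) <= M%:E * lp_norm p x)%E.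
Proof.
move=> M0 H x xp.
have fx : lp_norm p x \is a fin_num by rewrite ge0_fin_numE//; exact: Lnorm_ge0.
rewrite -[lp_norm p x]fineK// -EFinM; apply: H.
by rewrite /lp_le fineK.
Qed.

Lemma lp_bounded_operator_le (T : (nat -> R[i]) -> nat -> R[i]) :
  lp_bounded_operator p T ->
  exists2 M, 0 < M & forall x m, lp_le x m -> lp_le (T x) (M * m).
Proof.
(* The constant in the definition may be negative; the maximum with 1 makes it positive. *)
move=> [_ _ [M H]]; exists (Num.max 1 M); first by rewrite lt_max ltr01.
move=> x m xm; have m0 := lp_le_ge0 xm.
apply: le_trans (H x _) _; first by apply/lpP; exists m.
apply: (@le_trans _ _ ((Num.max 1 M)%:E * lp_norm p x)%E).
  by apply: lee_wpmul2r; [exact: Lnorm_ge0|rewrite lee_fin le_max lexx orbT].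
by rewrite EFinM; apply: lee_wpmul2l => //; rewrite lee_fin le_max ler01.
Qed.

End LpNormBounds.

(** * Limits along an ultrafilter *)

Lemma nat_ultrafilter_exists :
  exists G : set_system nat, UltraFilter G /\ (\oo : set_system nat) `<=` G.
Proof. exact: ultraFilterLemma. Qed.

(** A fixed free ultrafilter replaces diagonal extraction of subsequences: all bounded sequences
    converge along it simultaneously. *)
Definition nat_ultrafilter : set_system nat :=
  projT1 (cid nat_ultrafilter_exists).

Instance nat_ultrafilterP : UltraFilter nat_ultrafilter.
Proof. exact: (projT2 (cid nat_ultrafilter_exists)).1. Qed.

Lemma nat_ultrafilter_eventually (N : nat) (P : set nat) :
  (forall n, (N <= n)%N -> P n) -> nat_ultrafilter P.
Proof.
move=> NP; apply: (projT2 (cid nat_ultrafilter_exists)).2.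
by exists N.
Qed.

Section UltrafilterLimit.
Variable R : realType.
Implicit Types (u v : nat -> R[i]) (l m : R[i]) (M e : R).
Local Notation F := nat_ultrafilter.

Definition ucvg u l :=
  forall e, 0 < e -> F [set n | normc (u n - l) < e].

(** By compactness a cluster point [a] exists. Were a neighbourhood of [a] to have a preimage
    outside the ultrafilter, the complement would belong to it, which contradicts clustering. *)
Lemma ucvg_real (f : nat -> R) M : F [set n | `|f n| <= M] ->
  exists a, forall e, 0 < e -> F [set n | `|f n - a| < e].
Proof.
move=> fM.
have [|a [_ fa]] := @segment_compact R (- M) M (f @ F) _.
  by apply: filterS fM => n /=; rewrite in_itv/= ler_norml.
exists a => e e0.
have [//|nF] := in_ultra_setVsetC [set n | `|f n - a| < e] nat_ultrafilterP.
have [|_ [[n /= + <-]]] :=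
  fa (f @` (~` [set n | `|f n - a| < e])) (ball a e) _ (nbhsx_ballx a e e0).
  by apply: filterS nF => n nF; exists n.
by rewrite -ball_normE /= distrC.
Qed.

Lemma normc_le_ReIm (z : R[i]) : normc z <= `|complex.Re z| + `|complex.Im z|.
Proof.
rewrite [in leLHS](_ : z = ((complex.Re z)%:C + 'i * (complex.Im z)%:C)%C);
  last exact: complexE.
apply: le_trans (normc_triangle _ _) _; rewrite normcM !normc_real.
have -> : normc ('i%C : R[i]) = 1 by rewrite /normc /= expr0n expr1n add0r sqrtr1.
by rewrite mul1r.
Qed.

Lemma Re_le_normc (z : R[i]) : `|complex.Re z| <= normc z.
Proof.
case: z => a b; rewrite /normc /= -sqrtr_sqr; apply: ler_wsqrtr.
by rewrite lerDl sqr_ge0.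
Qed.

Lemma Im_le_normc (z : R[i]) : `|complex.Im z| <= normc z.
Proof.
case: z => a b; rewrite /normc /= -sqrtr_sqr; apply: ler_wsqrtr.
by rewrite lerDr sqr_ge0.
Qed.

Lemma ucvg_exists u M : F [set n | normc (u n) <= M] -> exists l, ucvg u l.
Proof.
move=> uM.
have [a Ha] : exists a, forall e, 0 < e -> F [set n | `|complex.Re (u n) - a| < e].
  apply: (@ucvg_real _ M); apply: filterS uM => n /=.
  exact: le_trans (Re_le_normc _).
have [b Hb] : exists a, forall e, 0 < e -> F [set n | `|complex.Im (u n) - a| < e].
  apply: (@ucvg_real _ M); apply: filterS uM => n /=.
  exact: le_trans (Im_le_normc _).
exists (a +i* b)%C => e e0; have e20 : 0 < e / 2 by lra.
apply: filterS2 (Ha _ e20) (Hb _ e20) => n /= Ra Ib.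
apply: le_lt_trans (normc_le_ReIm _) _; case: (u n) Ra Ib => c d /=; lra.
Qed.

Lemma ucvg_unique u l m : ucvg u l -> ucvg u m -> l = m.
Proof.
move=> ul um; apply/eqP; rewrite -subr_eq0 -normc_eq0; apply/negPn/negP => lm.
have d0 : 0 < normc (l - m) / 2.
  by have := normc_ge0 (l - m); rewrite le_eqVlt eq_sym (negbTE lm) /= => ?; lra.
have [n /= [a b]] := filter_ex (filterI (ul _ d0) (um _ d0)).
have := normc_triangle (l - u n) (u n - m).
rewrite addrA subrK normc_sub => ?; lra.
Qed.

Lemma ucvg_near u v l : F [set n | u n = v n] -> ucvg u l -> ucvg v l.
Proof. by move=> uv ul e e0; apply: filterS2 uv (ul e e0) => n /= ->. Qed.

Lemma ucvg_cst l : ucvg (fun=> l) l.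
Proof.
move=> e e0; apply: (@nat_ultrafilter_eventually 0) => n _ /=.
by rewrite subrr normc0.
Qed.

Lemma ucvgD u v l m : ucvg u l -> ucvg v m -> ucvg (fun n => u n + v n) (l + m).
Proof.
move=> ul vm e e0; have e20 : 0 < e / 2 by lra.
apply: filterS2 (ul _ e20) (vm _ e20) => n /= a b.
have -> : u n + v n - (l + m) = (u n - l) + (v n - m) by ring.
by apply: le_lt_trans (normc_triangle _ _) _; lra.
Qed.

Lemma ucvgM u v l m : ucvg u l -> ucvg v m -> ucvg (fun n => u n * v n) (l * m).
Proof.
move=> ul vm e e0.
have l0 := normc_ge0 l; have m0 := normc_ge0 m.
pose K := normc l + normc m + 1.
have K0 : 0 < K by rewrite /K; lra.
pose d := Num.min 1 (e / (2 * K)).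
have d0 : 0 < d by rewrite lt_min ltr01 divr_gt0// mulr_gt0.
apply: filterS2 (ul _ d0) (vm _ d0) => n /= a b.
have -> : u n * v n - l * m = (u n - l) * (v n - m) + (l * (v n - m) + (u n - l) * m).
  by ring.
apply: le_lt_trans (normc_triangle _ _) _.
apply: (@le_lt_trans _ _ (d * K)).
  have := normc_triangle (l * (v n - m)) ((u n - l) * m); rewrite !normcM => tri.
  have a0 := normc_ge0 (u n - l); have b0 := normc_ge0 (v n - m).
  have d1 : d <= 1 by rewrite /d ge_min lexx.
  rewrite /K; nra.
have : d <= e / (2 * K) by rewrite /d ge_min lexx orbT.
rewrite ler_pdivlMr; last by lra.
by move=> ?; nra.
Qed.

Lemma ucvg_le u l M : F [set n | normc (u n) <= M] -> ucvg u l -> normc l <= M.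
Proof.
move=> uM ul; rewrite leNgt; apply/negP => Ml.
have d0 : 0 < normc l - M by lra.
have [n /= [a b]] := filter_ex (filterI (ul _ d0) uM).
have := normc_triangle (l - u n) (u n).
by rewrite subrK normc_sub => ?; lra.
Qed.

Lemma ucvg_sum (I : Type) (s : seq I) (u : I -> nat -> R[i]) (l : I -> R[i]) :
  (forall i, ucvg (u i) (l i)) ->
  ucvg (fun n => \sum_(i <- s) u i n) (\sum_(i <- s) l i).
Proof.
move=> H; elim: s => [|i s IH].
  rewrite big_nil; apply: ucvg_near (ucvg_cst 0).
  by apply: (@nat_ultrafilter_eventually 0) => n _ /=; rewrite big_nil.
rewrite big_cons; apply: ucvg_near (ucvgD (H i) IH).
by apply: (@nat_ultrafilter_eventually 0) => n _ /=; rewrite big_cons.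
Qed.

(** The value is [0] by default when there is no limit; [ulimP] covers the bounded case. *)
Definition ulim u : R[i] := xget 0 [set l | ucvg u l].

Lemma ulimP u M : F [set n | normc (u n) <= M] -> ucvg u (ulim u).
Proof. by move=> /ucvg_exists[l ul]; exact: (@xgetI _ 0 [set l | ucvg u l] l). Qed.

Lemma ulimE u l : ucvg u l -> ulim u = l.
Proof.
by move=> ul; apply: (ucvg_unique _ ul); exact: (@xgetI _ 0 [set l | ucvg u l] l).
Qed.

End UltrafilterLimit.

(** * Decaying inverses of tridiagonal matrices *)

Lemma geometric_small (R : realType) (r K : R) : 0 <= r -> r < 1 ->
  forall e, 0 < e -> exists N, forall n, (N <= n)%N -> K * r ^+ n < e.
Proof.
move=> r0 r1 e e0.
have := @cvg_geometric R K r; rewrite ger0_norm// => /(_ r1) H.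
have := @cvgr_lt _ _ _ _ _ _ H e e0.
case=> N _ HN; exists N => n Nn; exact: HN.
Qed.

Lemma geometric_sum_le (R : realType) (r : R) n : 0 <= r -> r < 1 ->
  \sum_(k < n) r ^+ k <= (1 - r)^-1.
Proof.
move=> r0 r1; have h : 0 < 1 - r by lra.
rewrite -[leRHS]mul1r ler_pdivlMr//.
have -> : (\sum_(k < n) r ^+ k) * (1 - r) = 1 - r ^+ n.
  elim: n => [|n IH]; first by rewrite big_ord0 expr0 mul0r subrr.
  by rewrite big_ord_recr/= mulrDl IH exprS; ring.
by rewrite gerBl exprn_ge0.
Qed.

Section Tridiagonal.
Variable R : realType.
Implicit Types (A S : nat -> nat -> R[i]) (x y z h : nat -> R[i]) (tau K r : R).

Definition tridiagonal A :=
  forall i j, (i.+1 < j)%N || (j.+1 < i)%N -> A i j = 0.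

Definition entries_le A tau := forall i j, normc (A i j) <= tau.

(** The index type is a parameter because matrices over [nat] and over [int] are both transposed. *)
Definition transpose (I : Type) (A : I -> I -> R[i]) i j := A j i.

Lemma tridiagonal_tr A : tridiagonal A -> tridiagonal (transpose A).
Proof. by move=> tA i j ij; apply: tA; rewrite orbC. Qed.

Lemma tridiag_actE A x i : tridiagonal A -> tridiag_act A x i =
  (if i is k.+1 then A i k * x k else 0) + A i i * x i + A i i.+1 * x i.+1.
Proof.
move=> tA; rewrite /tridiag_act !big_ord_recr/=; congr (_ + _ + _).
case: i => [|i]; first by rewrite big_ord0.
rewrite big_ord_recr/= big1 ?add0r// => j _.
by rewrite tA ?mul0r//; have := ltn_ord j; lia.
Qed.

(** Green's formula for [A] and its transpose: summation by parts leaves only the boundary term that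
    couples the sites [n] and [n.+1]. *)
Lemma tridiag_act_summation A h z n : tridiagonal A ->
  \sum_(j < n.+1) h j * tridiag_act A z j =
  \sum_(j < n.+1) tridiag_act (transpose A) h j * z j +
    (h n * A n n.+1 * z n.+1 - h n.+1 * A n.+1 n * z n).
Proof.
move=> tA; elim: n => [|n IH].
  by rewrite !big_ord1 !tridiag_actE//; [rewrite /transpose; ring|exact: tridiagonal_tr].
rewrite big_ord_recr IH [in RHS]big_ord_recr/= !tridiag_actE//.
  by rewrite /transpose; ring.
exact: tridiagonal_tr.
Qed.

Definition decaying S K r :=
  [/\ 0 <= K, 0 < r, r < 1 & forall i j, normc (S i j) <= K * r ^+ `|i%:Z - j%:Z|%N].

Lemma decaying_tr S K r : decaying S K r -> decaying (transpose S) K r.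
Proof. by move=> [? ? ? H]; split=> // i j; rewrite distnC; exact: H. Qed.

Definition right_inverse_mx A S := forall i j, tridiag_act A (S^~ j) i = (i == j)%:R.

(** The identity [S A = I] is stated as [A^T S^T = I], so that both products are finite sums and the
    notion is symmetric under transposition. *)
Definition decaying_inverse A S := [/\ exists K r, decaying S K r,
  right_inverse_mx A S & right_inverse_mx (transpose A) (transpose S)].

Lemma decaying_inverse_tr A S :
  decaying_inverse A S -> decaying_inverse (transpose A) (transpose S).
Proof.
by move=> [[K [r /decaying_tr D]] AS SA]; split => //; exists K, r.
Qed.

Section LpAction.
Variable p : \bar R.
Hypothesis hp : (1%:E <= p)%E.

Lemma lp_le_diag (a : nat -> R[i]) x tau m : 0 <= tau ->
  (forall i, normc (a i) <= tau) ->
  lp_le p x m -> lp_le p (fun i => a i * x i) (tau * m).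
Proof.
move=> t0 aM xm; apply: (@lp_le_trans _ _ hp _ (fun i => (tau%:C)%C * x i)).
  move=> k; rewrite !normcM normc_real ger0_norm//.
  by apply: ler_wpM2r; [exact: normc_ge0|exact: aM].
by have := lp_leZ hp (tau%:C)%C xm; rewrite normc_real ger0_norm.
Qed.

Lemma lp_le_tridiag_act A tau x m : tridiagonal A -> entries_le A tau ->
  lp_le p x m -> lp_le p (tridiag_act A x) (3 * tau * m).
Proof.
move=> tA At xm; have t0 : 0 <= tau by apply: le_trans (normc_ge0 _) (At 0 0)%N.
have -> : 3 * tau * m = (tau * m + tau * m) + tau * m by ring.
(* At [i = 0] the coefficient [A i i.-1] is a diagonal entry, but it multiplies the value [0] of the
   shifted sequence. *)
have -> : tridiag_act A x = (fun i =>
    (A i i.-1 * (if i is k.+1 then x k else 0) + A i i * x i) + A i i.+1 * x i.+1).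
  by apply/funext => -[|i]; rewrite tridiag_actE//= mulr0.
apply: lp_leD => //; first apply: lp_leD => //.
- exact: (@lp_le_diag (fun i => A i i.-1) _ _ _ t0 _ (lp_le_shiftr hp xm)).
- exact: (@lp_le_diag (fun i => A i i) _ _ _ t0 (fun i => At _ _) xm).
- exact: (@lp_le_diag (fun i => A i i.+1) _ _ _ t0 _ (lp_le_shiftl hp xm)).
Qed.

Lemma tridiag_act_linear A (a : R[i]) x y :
  tridiag_act A (fun n => a * x n + y n) =
  (fun n => a * tridiag_act A x n + tridiag_act A y n).
Proof.
apply/funext => i; rewrite /tridiag_act mulr_sumr -big_split/=.
by apply: eq_bigr => j _; ring.
Qed.

Lemma tridiag_act_bounded A tau : tridiagonal A -> entries_le A tau ->
  lp_bounded_operator p (tridiag_act A).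
Proof.
move=> tA At; have t0 : 0 <= tau by apply: le_trans (normc_ge0 _) (At 0 0)%N.
split.
- move=> x /lpP [m xm]; apply/lpP; exists (3 * tau * m).
  exact: lp_le_tridiag_act.
- by move=> a x y _ _; exact: tridiag_act_linear.
- exists (3 * tau); apply: lp_le_operatorP => [|x m]; first by rewrite mulr_ge0.
  exact: lp_le_tridiag_act.
Qed.

End LpAction.
End Tridiagonal.

(** * Exponential decay of the entries of a bounded inverse *)

Section InverseDecay.
Variables (R : realType) (p : \bar R).
Hypothesis hp : (1%:E <= p)%E.
Implicit Types (A S : nat -> nat -> R[i]) (x y z h : nat -> R[i]) (tau K r : R).

Lemma normc_exp (z : R[i]) n : normc (z ^+ n) = normc z ^+ n.
Proof. by elim: n => [|n IH]; rewrite ?expr0 ?normc1// !exprS normcM IH. Qed.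

Lemma lp_le_norm x m : lp_le p x m -> lp_le p x (fine (lp_norm p x)) /\
  forall m', lp_le p x m' -> fine (lp_norm p x) <= m'.
Proof.
move=> xm; have xf : lp_norm p x \is a fin_num.
  by rewrite ge0_fin_numE; [exact: le_lt_trans xm (ltry _)|exact: Lnorm_ge0].
split=> [|m' xm']; first by rewrite /lp_le fineK.
by rewrite -lee_fin fineK.
Qed.

(* With [x i = rho ^+ minn `|i - j| N * s i] one has [A x = A s + A' x] where
   the entries of [A'] are at most [tau * (rho - 1)]. *)
Lemma weighted_column_le A (T : (nat -> R[i]) -> nat -> R[i]) tau M rho s j N :
  tridiagonal A -> entries_le A tau ->
  (forall x m, lp_le p x m -> lp_le p (T x) (M * m)) ->
  (forall x, lp p x -> T (tridiag_act A x) = x) ->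
  (forall i, tridiag_act A s i = (i == j)%:R) -> lp p s ->
  1 <= rho -> 0 < M -> M * (3 * (tau * (rho - 1))) <= 1 / 2 ->
  forall i, rho ^+ minn `|i%:Z - j%:Z|%N N * normc (s i) <= 2 * M.
Proof.
move=> tA At TM TA As /lpP[m sm] rho1 M0 Mr.
have rho0 : 0 < rho by apply: lt_le_trans rho1.
(* Capping the exponent at [N] keeps the weight bounded, so that [x] lies in l^p; the final estimate
   does not depend on [N]. *)
pose c := (rho%:C)%C; pose k i := minn `|i%:Z - j%:Z|%N N.
have normc_c : normc c = rho by rewrite /c normc_real gtr0_norm.
have c0 : c != 0 by rewrite -normc_eq0 normc_c gt_eqF.
pose x i := c ^+ k i * s i.
have [n xn] : exists n, lp_le p x n.
  exists (rho ^+ N * m); apply: (@lp_le_trans _ _ hp _ (fun i => c ^+ N * s i)).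
    move=> i; rewrite !normcM !normc_exp normc_c.
    apply: ler_wpM2r; first exact: normc_ge0.
    by apply: ler_weXn2l; rewrite // /k geq_minr.
  by have := lp_leZ hp (c ^+ N) sm; rewrite normc_exp normc_c.
have [xf fx] := lp_le_norm xn; set f := fine _ in xf fx.
pose A' i l := A i l * (1 - c ^+ k i / c ^+ k l).
have tA' : tridiagonal A' by move=> i l il; rewrite /A' tA ?mul0r.
have t0 : 0 <= tau by apply: le_trans (normc_ge0 _) (At 0 0)%N.
have A't : entries_le A' (tau * (rho - 1)).
  move=> i l; have r1 : 0 <= rho - 1 by lra.
  have [il|il] := boolP ((i.+1 < l) || (l.+1 < i))%N.
    by rewrite /A' tA// mul0r normc0 mulr_ge0.
  rewrite /A' normcM ler_pM ?normc_ge0//.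
  (* Inside the band the exponents differ by at most one, so the quotient of the weights is [1],
     [rho] or [rho^-1]. *)
  have : (k i = k l \/ k i = (k l).+1 \/ k l = (k i).+1)%N.
    by move: il; rewrite /k; lia.
  case=> [->|[->|->]].
  - by rewrite divff ?expf_neq0// subrr normc0.
  - rewrite exprS mulfK ?expf_neq0//.
    have -> : 1 - c = ((1 - rho)%:C)%C by rewrite rmorphB rmorph1.
    by rewrite normc_real ler0_norm//; lra.
  - have -> : c ^+ k i / c ^+ (k i).+1 = c^-1.
      by rewrite exprS invfM mulrCA divff ?mulr1// expf_neq0.
    have -> : 1 - c^-1 = ((1 - rho^-1)%:C)%C by rewrite rmorphB rmorph1 fmorphV.
    have rV : rho^-1 <= 1 by rewrite invf_le1.
    have rVr : rho^-1 * rho = 1 by rewrite mulVf ?gt_eqF.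
    have rV0 : 0 < rho^-1 by rewrite invr_gt0.
    by rewrite normc_real ger0_norm; nra.
have Ax : tridiag_act A x = (fun i => (i == j)%:R + tridiag_act A' x i).
  apply/funext => i.
  have -> : (i == j)%:R = c ^+ k i * tridiag_act A s i :> R[i].
    rewrite As; case: eqVneq => [->|_]; last by rewrite mulr0.
    by rewrite mulr1 /k distnn min0n expr0.
  rewrite /tridiag_act mulr_sumr -big_split/=; apply: eq_bigr => l _.
  rewrite /A' /x.
  have -> : A i l * (1 - c ^+ k i / c ^+ k l) * (c ^+ k l * s l) =
    A i l * (c ^+ k l * s l) - A i l * c ^+ k i * s l * (c ^+ k l / c ^+ k l) by ring.
  by rewrite divff ?expf_neq0//; ring.
have Axf : lp_le p (tridiag_act A x) (1 + 3 * (tau * (rho - 1)) * f).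
  rewrite Ax; apply: lp_leD => //; first exact: lp_le_delta.
  exact: lp_le_tridiag_act.
have := TM _ _ Axf; rewrite TA; last by apply/lpP; exists n.
move=> /fx fM i.
(* The bound [fM] and the smallness of [rho - 1] give [f <= M + f / 2]. *)
have f2M : f <= 2 * M by have := lp_le_ge0 xf; nra.
apply: le_trans f2M; have := lp_le_coord hp i xf.
by rewrite /x normcM normc_exp normc_c.
Qed.

(** The columns of [S] are the images [T e_j] of the unit vectors. [A T = I] gives the first matrix
    identity; the second comes from applying [T] to [A e_j], which has at most three nonzero
    entries. *)
Lemma lp_invertible_decaying_inverse A tau :
  tridiagonal A -> entries_le A tau -> lp_invertible p (tridiag_act A) ->
  exists S, decaying_inverse A S.
Proof.
move=> tA At [_ [T [bT TA]]].
have t0 : 0 <= tau by apply: le_trans (normc_ge0 _) (At 0 0)%N.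
have [M M0 TM] := lp_bounded_operator_le bT.
have [_ linT _] := bT.
pose e j : nat -> R[i] := fun k => (k == j)%:R.
have le_e j : lp_le p (e j) 1 by exact: lp_le_delta.
have lp_e j : lp p (e j) by apply/lpP; exists 1.
have lp_Te j : lp p (T (e j)) by apply/lpP; exists (M * 1); exact: TM.
have ATe j i : tridiag_act A (T (e j)) i = (i == j)%:R.
  by have [_ ->] := TA _ (lp_e j).
exists (fun i j => T (e j) i); split; last first.
- move=> j i; rewrite /transpose.
  have lp_D a b : lp p a -> lp p b -> lp p (fun n => a n + b n).
    move=> /lpP[m1 am] /lpP[m2 bm]; apply/lpP.
    by exists (m1 + m2); exact: lp_leD.
  have lp_Z a b : lp p b -> lp p (fun n => a * b n).
    move=> /lpP[m bm]; apply/lpP.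
    by exists (normc a * m); exact: lp_leZ.
  have lp0 : lp p (fun=> 0 : R[i]).
    have -> : (fun=> 0 : R[i]) = (fun n => 0 * e 0%N n).
      by apply/funext => n; rewrite mul0r.
    exact: lp_Z.
  have T0 : T (fun=> 0) = (fun=> 0).
    have := linT 1 _ _ lp0 lp0; have -> : (fun _ : nat => 1 * 0 + 0 : R[i]) = (fun=> 0).
      by apply/funext => n; rewrite mulr0 addr0.
    move=> E; apply/funext => n; have /(congr1 (fun f => f n)) /= := E.
    by rewrite mul1r => /eqP; rewrite -subr_eq0 opprD addNKr oppr_eq0 => /eqP.
  have TZ a b : lp p b -> T (fun n => a * b n) = (fun n => a * T b n).
    move=> lpb; have := linT a _ _ lpb lp0; rewrite T0.
    under eq_fun do rewrite addr0; move=> ->.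
    by apply/funext => n; rewrite addr0.
  (* For [j = 0] the vector [e j.-1] is again [e 0], but its coefficient is set to zero. *)
  have Ae : tridiag_act A (e j) = (fun n => A j.+1 j * e j.+1 n +
      (A j j * e j n + (if j is l.+1 then A l j else 0) * e j.-1 n)).
    apply/funext => n; rewrite tridiag_actE// /e.
    have -> : A n n * (n == j)%:R = A j j * (n == j)%:R.
      by case: eqVneq => [->|]; rewrite ?mulr0.
    have -> : A n n.+1 * (n.+1 == j)%:R =
        (if j is l.+1 then A l j else 0) * (n == j.-1)%:R.
      case: (j) => [|l]; first by rewrite mulr0 mul0r.
      by rewrite eqSS; case: eqVneq => [->|]; rewrite ?mulr0.
    have -> : (if n is k.+1 then A n k * (k == j)%:R else 0) = A j.+1 j * (n == j.+1)%:R.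
      case: n => [|n]; first by rewrite mulr0.
      by rewrite eqSS; case: eqVneq => [->|]; rewrite ?mulr0.
    by rewrite addrA.
  have [TAe _] := TA _ (lp_e j).
  have /(congr1 (fun f => f i)) := TAe.
  rewrite Ae linT//; last by apply: lp_D; exact: lp_Z.
  have lpj : lp p (fun n => (if j is l.+1 then A l j else 0) * e j.-1 n) by exact: lp_Z.
  rewrite linT// TZ// /e eq_sym => <-.
  rewrite tridiag_actE; last exact: tridiagonal_tr.
  by case: (j) => [|l] /=; ring.
- by move=> i j; exact: ATe.
(* This choice turns the smallness condition into [3 M tau / (6 M tau + 1) <= 1 / 2]; the summand
   [1] in the denominator covers [tau = 0]. *)
pose rho := 1 + (6 * M * tau + 1)^-1.
have d0 : 0 < 6 * M * tau + 1 by nra.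
have rho1 : 1 < rho by rewrite /rho ltrDl invr_gt0.
exists (2 * M), rho^-1; split.
- by nra.
- by rewrite invr_gt0; lra.
- by rewrite invf_lt1//; lra.
move=> i j; have Mr : M * (3 * (tau * (rho - 1))) <= 1 / 2.
  have -> : M * (3 * (tau * (rho - 1))) = (3 * M * tau) / (6 * M * tau + 1).
    by rewrite /rho; ring.
  by rewrite ler_pdivrMr//; lra.
have invTA x : lp p x -> T (tridiag_act A x) = x by move=> /TA[].
(* With the cap equal to the distance of [i] and [j], the weight at [i] is the full power of
   [rho]. *)
have := @weighted_column_le A T tau M rho _ j `|i%:Z - j%:Z|%N tA At TM invTA
  (ATe j) (lp_Te j) (ltW rho1) M0 Mr i.
rewrite minnn exprVn mulrC -ler_pdivlMr//.
by apply: exprn_gt0; lra.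
Qed.

End InverseDecay.

(** * Decaying inverse matrices as bounded inverses on l^p *)

Section DecayingInverse.
Variables (R : realType) (p : \bar R).
Hypothesis hp : (1%:E <= p)%E.
Implicit Types (A S : nat -> nat -> R[i]) (x y z h : nat -> R[i]) (tau K r : R).

Lemma lp_le_shiftl_iter x M d : lp_le p x M -> lp_le p (fun i => x (i + d)%N) M.
Proof.
move=> xM; elim: d => [|d IH].
  by under eq_fun do rewrite addn0.
by under eq_fun do rewrite addnS -addSn; exact: (lp_le_shiftl hp IH).
Qed.

Lemma lp_le_shiftr_iter x M d : lp_le p x M ->
  lp_le p (fun i => if (d <= i)%N then x (i - d)%N else 0) M.
Proof.
move=> xM; elim: d => [|d IH].
  by under eq_fun do rewrite subn0.
have := lp_le_shiftr hp IH; apply: lp_le_trans => // -[|i]//=.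
Qed.

Lemma lp_le_eps x M : (forall e, 0 < e -> lp_le p x (M + e)) -> lp_le p x M.
Proof. by move=> H; apply/lee_addgt0Pr => e e0; rewrite -EFinD; exact: H. Qed.

(** A Fatou property. On the first [N] coordinates a single [n] brings [u n] within [d] of [x]; the
    correction is a sum of [N] multiples of unit vectors, of norm at most [N d <= e]. *)
Lemma lp_le_ucvg (u : nat -> nat -> R[i]) x M :
  (forall n, lp_le p (u n) M) -> (forall i, ucvg (u^~ i) (x i)) -> lp_le p x M.
Proof.
move=> uM ux; have M0 := lp_le_ge0 (uM 0%N).
apply: lp_le_trunc => // N; exists (fun i => if (i < N)%N then x i else 0); last first.
  by move=> k ->.
apply: lp_le_eps => e e0.
pose d := e / N.+1%:R.
have d0 : 0 < d by rewrite divr_gt0.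
have /filter_ex [n Hn] : nat_ultrafilter
    [set n | forall i : 'I_N, normc (u n i - x i) < d].
  by apply: filter_forall => i; exact: ux.
have -> : (fun i => if (i < N)%N then x i else 0) =
    (fun i => (if (i < N)%N then u n i else 0) +
              \sum_(j < N) (x j - u n j) * (i == j)%:R).
  apply/funext => i; case: ltnP => iN.
    rewrite (bigD1 (Ordinal iN))//= eqxx mulr1 big1 => [|j].
      by rewrite addr0 addrC subrK.
    by rewrite -val_eqE/= eq_sym => /negbTE ->; rewrite mulr0.
  by rewrite big1 ?addr0// => j _; rewrite gtn_eqF ?mulr0// (leq_trans _ iN).
apply: (@le_lp_le _ _ _ (M + \sum_(j < N) d)).
  rewrite lerD2l sumr_const card_ord -mulr_natr /d -mulrA ger_pMr//.
  by rewrite mulrC ler_pdivrMr// mul1r ler_nat.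
apply: lp_leD => //.
  apply: (lp_le_trans hp _ (uM n)) => i; case: ifP => // _.
  by rewrite normc0 normc_ge0.
apply: lp_le_sum => // j; apply: (@le_lp_le _ _ _ (normc (x j - u n j) * 1)).
  by rewrite mulr1 normc_sub ltW.
by apply: lp_leZ => //; exact: lp_le_delta.
Qed.

(** [S] is split into diagonals. Each one acts as a shift and a multiplication by entries of size at
    most [K * r ^+ d]; a geometric series bounds each of the two triangles, whence the factor 2. *)
Lemma partial_sums_le S K r x m n : decaying S K r -> lp_le p x m ->
  lp_le p (fun i => \sum_(j < n) S i j * x j) (2 * (K / (1 - r)) * m).
Proof.
move=> [K0 r0 r1 Sr] xm; have m0 := lp_le_ge0 xm.
have C0 : 0 <= K / (1 - r) by apply: divr_ge0 => //; lra.
apply: (lp_le_trunc hp) => [|N]; first by rewrite !mulr_ge0// invr_ge0; lra.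
pose t i j := if (j < n)%N then S i j * x j else 0.
(* [f d] comes from the [d]-th diagonal on the right, the main one being [f 0], and [g d] from the
   [d.+1]-th diagonal on the left. *)
pose f d i := t i (i + d)%N.
pose g d i := if (d < i)%N then t i (i - d.+1)%N else 0.
have tle i j : normc (t i j) <= K * r ^+ `|i%:Z - j%:Z|%N * normc (x j).
  rewrite /t; case: ifP => _; last first.
    by rewrite normc0 !mulr_ge0 ?normc_ge0 ?exprn_ge0// ltW.
  by rewrite normcM; apply: ler_wpM2r; [exact: normc_ge0|exact: Sr].
have Kr d : normc ((K * r ^+ d)%:C)%C = K * r ^+ d.
  by rewrite normc_real ger0_norm// mulr_ge0// exprn_ge0// ltW.
have fle d : lp_le p (f d) (K * r ^+ d * m).
  have := lp_leZ hp ((K * r ^+ d)%:C)%C (lp_le_shiftl_iter d xm).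
  rewrite Kr; apply: lp_le_trans => // i; rewrite normcM Kr.
  apply: le_trans (tle _ _) _; have -> : `|i%:Z - (i + d)%N%:Z|%N = d by lia.
  by [].
have gle d : lp_le p (g d) (K * r ^+ d * m).
  have := lp_leZ hp ((K * r ^+ d)%:C)%C (lp_le_shiftr_iter d.+1 xm).
  rewrite Kr; apply: lp_le_trans => // i; rewrite normcM Kr /g.
  case: ltnP => di; last by rewrite normc0 mulr0.
  apply: le_trans (tle _ _) _; have -> : `|i%:Z - (i - d.+1)%N%:Z|%N = d.+1 by lia.
  apply: ler_wpM2r; first exact: normc_ge0.
  apply: ler_wpM2l => //; rewrite exprS ger_pMl ?exprn_gt0//; exact: ltW.
exists (fun i => \sum_(d < N) g d i + \sum_(d < n) f d i).
  apply: (@le_lp_le _ _ _ (\sum_(d < N) K * r ^+ d * m + \sum_(d < n) K * r ^+ d * m)).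
    rewrite -!mulr_suml -!mulr_sumr -mulrDl; apply: ler_wpM2r => //.
    have h k : K * \sum_(d < k) r ^+ d <= K / (1 - r).
      by apply: ler_wpM2l => //; apply: geometric_sum_le => //; exact: ltW.
    by have := h N; have := h n; lra.
  by apply: lp_leD => //; apply: lp_le_sum.
move=> i iN.
have -> : \sum_(j < n) S i j * x j = \sum_(j < i + n) t i j.
  by rewrite (big_ord_widen (i + n) (fun j => S i j * x j)) ?leq_addl// big_mkcond.
rewrite big_split_ord/=; congr (_ + _); rewrite [RHS](reindex_inj rev_ord_inj)/=.
by rewrite (big_ord_widen N (fun d => t i (i - d.+1)%N) (ltnW iN)) [RHS]big_mkcond.
Qed.

(** The series for [S x], summed along the ultrafilter; bounded partial sums are enough for this
    limit to exist. *)
Definition sum_op S x i := ulim (fun n => \sum_(j < n) S i j * x j).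

Lemma sum_op_cvg S K r x m i : decaying S K r -> lp_le p x m ->
  ucvg (fun n => \sum_(j < n) S i j * x j) (sum_op S x i).
Proof.
move=> Sr xm; apply: (@ulimP _ _ (2 * (K / (1 - r)) * m)).
apply: (@nat_ultrafilter_eventually 0) => n _ /=.
exact: (lp_le_coord hp i (partial_sums_le n Sr xm)).
Qed.

Lemma sum_op_bounded S K r : decaying S K r -> lp_bounded_operator p (sum_op S).
Proof.
move=> Sr; have [K0 r0 r1 _] := Sr.
have C0 : 0 <= 2 * (K / (1 - r)).
  by apply: mulr_ge0 => //; apply: divr_ge0 => //; lra.
have bS x m : lp_le p x m -> lp_le p (sum_op S x) (2 * (K / (1 - r)) * m).
  move=> xm; apply: (lp_le_ucvg (fun n => partial_sums_le n Sr xm)) => i.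
  exact: sum_op_cvg Sr xm.
split; last by exists (2 * (K / (1 - r))); exact: lp_le_operatorP.
- by move=> x /lpP[m xm]; apply/lpP; exists (2 * (K / (1 - r)) * m); exact: bS.
- move=> a x y /lpP[m xm] /lpP[n yn]; apply/funext => i.
  apply: ulimE.
  apply: ucvg_near (ucvgD (ucvgM (ucvg_cst a) (sum_op_cvg i Sr xm)) (sum_op_cvg i Sr yn)).
  apply: (@nat_ultrafilter_eventually 0) => k _ /=.
  by rewrite mulr_sumr -big_split/=; apply: eq_bigr => j _; ring.
Qed.

Lemma ucvg_geometric (u : nat -> R[i]) K r N : 0 <= r -> r < 1 ->
  (forall n, (N <= n)%N -> normc (u n) <= K * r ^+ (n - N)) -> ucvg u 0.
Proof.
move=> r0 r1 H e e0; have [M HM] := geometric_small K r0 r1 e0.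
apply: (@nat_ultrafilter_eventually (N + M)) => n nNM /=.
rewrite subr0; apply: le_lt_trans (H n _) (HM _ _); lia.
Qed.

Lemma ucvg_delta x (i : nat) :
  ucvg (fun n => \sum_(j < n) (i == j)%:R * x j) (x i).
Proof.
apply: ucvg_near (ucvg_cst _); apply: (@nat_ultrafilter_eventually i.+1) => n ni /=.
rewrite (bigD1 (Ordinal ni))//= eqxx mul1r big1 ?addr0// => j.
by rewrite -val_eqE/= eq_sym => /negbTE ->; rewrite mul0r.
Qed.

Lemma decaying_inverse_lp_invertible A S tau :
  tridiagonal A -> entries_le A tau -> decaying_inverse A S ->
  lp_invertible p (tridiag_act A).
Proof.
move=> tA At [[K [r Sr]] AS SA]; split; first exact: (tridiag_act_bounded hp tA At).
exists (sum_op S); split; first exact: sum_op_bounded Sr.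
have t0 : 0 <= tau by apply: le_trans (normc_ge0 _) (At 0 0)%N.
move=> x /lpP[m xm]; have m0 := lp_le_ge0 xm.
have [K0 r0 r1 Sle] := Sr; split; apply/funext => i.
  (* [c n] is the boundary term in Green's formula and decays geometrically. A partial sum of [n]
     terms has the boundary term [c n.-1]. *)
  apply: ulimE; pose c n := S i n * A n n.+1 * x n.+1 - S i n.+1 * A n.+1 n * x n.
  have c0 : ucvg (fun n => c n.-1) 0.
    apply: (@ucvg_geometric _ (2 * (K * tau * m)) r i.+1) => //; first exact: ltW.
    case=> // n ni; rewrite /c /= subSS.
    have h k l q : (n <= k)%N ->
        normc (S i k * A l q * x q) <= K * tau * m * r ^+ (n - i).
      move=> nk; rewrite !normcM.
      have -> : K * tau * m * r ^+ (n - i) = K * r ^+ (n - i) * tau * m by ring.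
      apply: ler_pM; rewrite ?mulr_ge0 ?normc_ge0//; last exact: lp_le_coord xm.
      apply: ler_pM; rewrite ?mulr_ge0 ?normc_ge0//.
      apply: le_trans (Sle _ _) _; apply: ler_wpM2l => //.
      by apply: ler_wiXn2l; [exact: ltW|exact: ltW|lia].
    apply: le_trans (normc_triangle _ _) _; rewrite normcN.
    have := h n n n.+1 (leqnn _); have := h n.+1 n.+1 n (leqnSn _).
    by rewrite -mulrA; lra.
  have := ucvgD (ucvg_delta x i) c0; rewrite addr0; apply: ucvg_near.
  apply: (@nat_ultrafilter_eventually 1) => -[//|n] _ /=.
  rewrite tridiag_act_summation//; congr (_ + _); apply: eq_bigr => j _.
  by rewrite eq_sym -(SA j i).
(* For the other composition, a row of [A] acts as a finite sum and hence commutes with the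
   limit. *)
have AS_cvg : ucvg (fun n => \sum_(l < i.+2) A i l * \sum_(j < n) S l j * x j)
    (tridiag_act A (sum_op S x) i).
  apply: ucvg_sum => l; apply: ucvgM (ucvg_cst _) _.
  exact: sum_op_cvg Sr xm.
apply: ucvg_unique AS_cvg _; apply: ucvg_near (ucvg_delta x i).
apply: (@nat_ultrafilter_eventually 0) => n _ /=.
under eq_bigr do rewrite -AS /tridiag_act mulr_suml.
rewrite exchange_big/=; apply: eq_bigr => l _; rewrite mulr_sumr.
by apply: eq_bigr => j _; rewrite mulrA.
Qed.

End DecayingInverse.

(** * Bi-infinite matrices *)

Section BiInfinite.
Variable R : realType.
Implicit Types (A G : int -> int -> R[i]) (z h : int -> R[i]) (tau K r m : R).

Definition zact A z (i : int) :=
  A i (i - 1) * z (i - 1) + A i i * z i + A i (i + 1) * z (i + 1).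

Definition zdecaying G K r :=
  [/\ 0 <= K, 0 < r, r < 1 & forall i j, normc (G i j) <= K * r ^+ `|i - j|%N].

Lemma le0_geometric (a C r : R) : 0 <= r -> r < 1 ->
  (forall n, a <= C * r ^+ n) -> a <= 0.
Proof.
move=> r0 r1 H; rewrite leNgt; apply/negP => a0.
have [N /(_ _ (leqnn _))] := geometric_small C r0 r1 a0.
by rewrite ltNge H.
Qed.

(* The discrete Wronskian [c] of [h] and [z] is constant on either side of
   [i], it decays at infinity, and its jump at [i] is [- z i]. *)
Lemma zact_kernel A h z tau K r m (i : int) :
  0 <= K -> 0 < r -> r < 1 ->
  (forall j, normc (h j) <= K * r ^+ `|i - j|%N) ->
  (forall j k, normc (A j k) <= tau) -> (forall j, normc (z j) <= m) ->
  (forall j, zact (transpose A) h j = (i == j)%:R) ->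
  (forall j, zact A z j = 0) -> z i = 0.
Proof.
move=> K0 r0 r1 hK At zm hA Az.
pose c j := h j * A j (j + 1) * z (j + 1) - h (j + 1) * A (j + 1) j * z j.
have jump j : c j - c (j - 1) = - ((i == j)%:R * z j).
  rewrite -hA; have -> : c j - c (j - 1) = h j * zact A z j -
      zact (transpose A) h j * z j.
    by rewrite /c /zact /transpose subrK; ring.
  by rewrite Az mulr0 sub0r.
have right n : c (i + n%:Z) = c i.
  elim: n => [|n IH]; first by rewrite addr0.
  have := jump (i + n.+1%:Z).
  have -> : (i == i + n.+1%:Z) = false by lia.
  have -> : i + n.+1%:Z - 1 = i + n%:Z by lia.
  by rewrite mul0r oppr0 IH => /eqP; rewrite subr_eq0 => /eqP.
have left n : c (i - 1 - n%:Z) = c (i - 1).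
  elim: n => [|n IH]; first by rewrite subr0.
  have := jump (i - 1 - n%:Z).
  have -> : (i == i - 1 - n%:Z) = false by lia.
  have -> : i - 1 - n%:Z - 1 = i - 1 - n.+1%:Z by lia.
  by rewrite mul0r oppr0 IH => /eqP; rewrite subr_eq0 => /eqP.
have cle j n : (n <= `|i - j|)%N -> (n <= `|i - (j + 1)%R|)%N ->
    normc (c j) <= 2 * (K * tau * m) * r ^+ n.
  have hle l (a b : int) q : (n <= `|i - l|)%N ->
      normc (h l * A a b * z q) <= K * tau * m * r ^+ n.
    move=> nl; rewrite !normcM.
    have -> : K * tau * m * r ^+ n = K * r ^+ n * tau * m by ring.
    apply: ler_pM; rewrite ?mulr_ge0 ?normc_ge0//.
    apply: ler_pM; rewrite ?normc_ge0//.
    apply: le_trans (hK _) _; apply: ler_wpM2l => //.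
    by apply: ler_wiXn2l => //; exact: ltW.
  move=> n1 n2; apply: le_trans (normc_triangle _ _) _; rewrite normcN.
  have := hle j j (j + 1) (j + 1) n1; have := hle (j + 1) (j + 1) j j n2.
  by lra.
have ci : c i = 0.
  apply: eq0_normc; apply/eqP; rewrite eq_le normc_ge0 andbT.
  apply: (le0_geometric (ltW r0) r1) => n; rewrite -(right n); apply: cle; lia.
have ci1 : c (i - 1) = 0.
  apply: eq0_normc; apply/eqP; rewrite eq_le normc_ge0 andbT.
  apply: (le0_geometric (ltW r0) r1) => n; rewrite -(left n); apply: cle; lia.
by have := jump i; rewrite ci ci1 subrr eqxx mul1r => /esym/eqP; rewrite oppr_eq0 => /eqP.
Qed.

Definition zdecaying_inverse A G := [/\ exists K r, zdecaying G K r,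
  forall i j, zact A (G^~ j) i = (i == j)%:R &
  forall i j, zact (transpose A) (G i) j = (i == j)%:R].

(** Each row of [G] serves as the decaying vector [h] of [zact_kernel], so [A] is injective on
    bounded sequences. *)
Lemma zdecaying_inverse_kernel A G tau z m : zdecaying_inverse A G ->
  (forall j k, normc (A j k) <= tau) -> (forall j, normc (z j) <= m) ->
  (forall j, zact A z j = 0) -> forall i, z i = 0.
Proof.
move=> [[K [r [K0 r0 r1 GK]]] _ GA] At zm Az i.
by apply: (zact_kernel K0 r0 r1 (GK i) At zm) => // j; rewrite GA.
Qed.

(** * Limits of recentred copies of a matrix *)

Section LimitOperator.
Variable o : nat -> nat.
Hypothesis le_o : forall n, (n <= o n)%N.
Implicit Types (B S : nat -> nat -> R[i]).

(** [absz] only turns the indices into natural numbers: once [n] is at least [|i|] and [|j|], [le_o]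
    makes both arguments nonnegative. *)
Definition recentre B n (i j : int) := B (absz ((o n)%:Z + i)) (absz ((o n)%:Z + j)).

Definition limit_mx S (i j : int) := ulim (fun n => recentre S n i j).

Lemma limit_mx_cvg S K r i j : decaying S K r ->
  ucvg (fun n => recentre S n i j) (limit_mx S i j).
Proof.
move=> [K0 r0 r1 Sr]; apply: (@ulimP _ _ K).
apply: (@nat_ultrafilter_eventually 0) => n _ /=.
apply: le_trans (Sr _ _) _; rewrite -[leRHS]mulr1; apply: ler_wpM2l => //.
by apply: exprn_ile1; exact: ltW.
Qed.

Lemma limit_mx_decaying S K r : decaying S K r -> zdecaying (limit_mx S) K r.
Proof.
move=> Sr; have [K0 r0 r1 Sle] := Sr; split => // i j.
apply: ucvg_le (limit_mx_cvg i j Sr).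
apply: (@nat_ultrafilter_eventually (`|i| + `|j|)) => n nij /=.
have on := le_o n; have := Sle (absz ((o n)%:Z + i)) (absz ((o n)%:Z + j)).
by rewrite (_ : absz (_ - _) = `|i - j|%N)//; lia.
Qed.

Lemma limit_mx_right_inverse B S A K r : tridiagonal B ->
  (forall i j : int, (`|i - j| <= 1)%N -> ucvg (fun n => recentre B n i j) (A i j)) ->
  decaying S K r -> right_inverse_mx B S ->
  forall i j, zact A (limit_mx S ^~ j) i = (i == j)%:R.
Proof.
move=> tB BA Sr BS i j.
have H k : (`|i - k| <= 1)%N -> ucvg (fun n => recentre B n i k * recentre S n k j)
    (A i k * limit_mx S k j).
  by move=> ik; apply: ucvgM (BA _ _ ik) (limit_mx_cvg _ _ Sr).
have L : ucvg (fun n => zact (recentre B n) (recentre S n ^~ j) i)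
    (zact A (limit_mx S ^~ j) i).
  by apply: ucvgD; [apply: ucvgD|]; apply: H; lia.
apply: ucvg_unique L _; apply: ucvg_near (ucvg_cst _).
(* For such [n] the recentred row stays off the boundary row [0], and [absz] preserves the order of
   the indices involved. *)
apply: (@nat_ultrafilter_eventually (`|i| + `|j| + 2)) => n nij /=.
have on := le_o n.
have -> : (i == j) = ((absz ((o n)%:Z + i)) == (absz ((o n)%:Z + j))) by lia.
rewrite -BS tridiag_actE// /zact /recentre.
have -> : (absz ((o n)%:Z + i)) = (absz ((o n)%:Z + (i - 1))).+1 by lia.
by have -> : (absz ((o n)%:Z + (i + 1))) = (absz ((o n)%:Z + (i - 1))).+2 by lia.
Qed.

Lemma limit_mx_inverse B S A : tridiagonal B ->
  (forall i j : int, (`|i - j| <= 1)%N -> ucvg (fun n => recentre B n i j) (A i j)) ->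
  decaying_inverse B S -> zdecaying_inverse A (limit_mx S).
Proof.
move=> tB BA [[K [r Sr]] BS SB]; split.
- by exists K, r; exact: limit_mx_decaying.
- exact: (limit_mx_right_inverse tB BA Sr BS).
- move=> i j; rewrite eq_sym.
  apply: (limit_mx_right_inverse (tridiagonal_tr tB) _ (decaying_tr Sr) SB).
  by move=> k l kl; apply: BA; rewrite distnC.
Qed.

End LimitOperator.
End BiInfinite.

(** * Pseudoergodic matrices *)

Section Pseudoergodic.
Variable R : realType.
Implicit Types (U V W : set R[i]) (A B : nat -> nat -> R[i]) (tau : R).

Lemma mx_norm_entry_le (K : numDomainType) m n (M : 'M[K]_(m, n)) i j :
  `|M i j| <= `|M|.
Proof.
rewrite [leRHS]/Num.norm/= mx_normE.
change ((`|M i j|%:nng)%:num <= (\big[Num.max/0%:nng]_k `|M k.1 k.2|%:nng)%:num).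
rewrite num_le.
exact: (le_bigmax _ (fun k : 'I_m * 'I_n => `|M k.1 k.2|%:nng) (i, j)).
Qed.

Lemma normc_lt (z : R[i]) (e : R) : `|z| < (e%:C)%C -> normc z < e.
Proof. by rewrite normc_def ltcR; case: z. Qed.

(** Entries off the three central diagonals are left free, since [zact] does not read them. *)
Definition zMplus U V W : set (int -> int -> R[i]) :=
  [set A | forall i, [/\ U (A i (i - 1)), V (A i i) & W (A i (i + 1))]].

Lemma Mplus_tridiagonal U V W A : Mplus U V W A -> tridiagonal A.
Proof.
move=> MA i j ij; have := MA i j; rewrite /tridiag_entry.
have -> : (i == j.+1) = false by lia.
have -> : (i == j) = false by lia.
by have -> : (j == i.+1) = false by lia.
Qed.

Lemma Mplus_sub U V W A i : Mplus U V W A -> U (A i.+1 i).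
Proof. by move=> /(_ i.+1 i); rewrite /tridiag_entry eqxx. Qed.

Lemma Mplus_diag U V W A i : Mplus U V W A -> V (A i i).
Proof.
by move=> /(_ i i); rewrite /tridiag_entry eqxx; have -> : (i == i.+1) = false by lia.
Qed.

Lemma Mplus_sup U V W A i : Mplus U V W A -> W (A i i.+1).
Proof.
move=> /(_ i i.+1); rewrite /tridiag_entry eqxx.
have -> : (i == i.+2) = false by lia.
by have -> : (i == i.+1) = false by lia.
Qed.

Definition bounded_entries U V W tau := forall a, U a \/ V a \/ W a -> normc a <= tau.

Lemma Mplus_entries_le U V W tau A : bounded_entries U V W tau ->
  Mplus U V W A -> entries_le A tau.
Proof.
move=> UVWt MA.
have t0 : 0 <= tau.
  apply: le_trans (normc_ge0 _) (UVWt (A 0%N 0%N) _).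
  by right; left; exact: Mplus_diag MA.
move=> i j; have := MA i j; rewrite /tridiag_entry.
case: ifP => [_ ?|_]; first by apply: UVWt; left.
case: ifP => [_ ?|_]; first by apply: UVWt; right; left.
case: ifP => [_ ?|_ ->]; first by apply: UVWt; right; right.
by rewrite normc0.
Qed.

(** The window of [A] over the sites from [-n] to [n] is a tridiagonal matrix of size [2 n + 1]. Its
    approximate copy in [B] starts at row [k], so its centre is [k + n]. *)
Lemma PsiEplus_block U V W B (A : int -> int -> R[i]) n :
  PsiEplus U V W B -> zMplus U V W A ->
  exists k : nat, forall i j : int, (absz i <= n)%N -> (absz j <= n)%N ->
    (absz (i - j) <= 1)%N ->
    normc (A i j - B (absz ((k + n)%:Z + i)) (absz ((k + n)%:Z + j))) < n.+1%:R^-1.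
Proof.
move=> [MB PB] MA.
(* Entries outside the band are set to zero because [zMplus] does not constrain them. *)
pose F := \matrix_(p < (n + n).+1, q < (n + n).+1)
  (if (p <= q.+1)%N && (q <= p.+1)%N then A (p%:Z - n%:Z) (q%:Z - n%:Z) else 0).
have MF : Mfin U V W F.
  move=> p q; rewrite mxE /tridiag_entry.
  have [U1 V1 W1] := MA (p%:Z - n%:Z).
  have [pq|pq] := eqVneq (p : nat) q.+1.
    case: ifP => [_|]; last by lia.
    by have -> : q%:Z - n%:Z = p%:Z - n%:Z - 1 by lia.
  have [pq'|pq'] := eqVneq (p : nat) q.
    case: ifP => [_|]; last by lia.
    by have -> : q%:Z - n%:Z = p%:Z - n%:Z by lia.
  have [qp|qp] := eqVneq (q : nat) p.+1.
    case: ifP => [_|]; last by lia.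
    by have -> : q%:Z - n%:Z = p%:Z - n%:Z + 1 by lia.
  by case: ifP => //; lia.
have n0 : 0 < n.+1%:R^-1 :> R by rewrite invr_gt0.
have [k Hk] := PB _ F _ (ltn0Sn _) MF n0.
exists k => i j ni nj ij.
have pi : (absz (i + n%:Z)%R < (n + n).+1)%N by lia.
have pj : (absz (j + n%:Z)%R < (n + n).+1)%N by lia.
apply: normc_lt; apply: le_lt_trans Hk.
have := mx_norm_entry_le (F - diag_submx B k (n + n).+1) (Ordinal pi) (Ordinal pj).
rewrite !mxE/=; congr (_ <= _).
have -> : (absz (i + n%:Z)%R <= (absz (j + n%:Z)%R).+1)%N &&
    (absz (j + n%:Z)%R <= (absz (i + n%:Z)%R).+1)%N.
  by lia.
congr (`| _ - _|); [congr A|congr B]; lia.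
Qed.

(** [A] is the limit of copies of [B] recentred at the windows of [PsiEplus_block], so the limit of
    the corresponding copies of [S] inverts it. *)
Lemma PsiEplus_zinverse U V W B S (A : int -> int -> R[i]) : PsiEplus U V W B ->
  decaying_inverse B S -> zMplus U V W A -> exists G, zdecaying_inverse A G.
Proof.
move=> PB BS MA.
have /choice [k Hk] := fun n => PsiEplus_block n PB MA.
pose o n := (k n + n)%N.
have le_o n : (n <= o n)%N by rewrite leq_addl.
exists (limit_mx o S); apply: (limit_mx_inverse le_o _ _ BS).
  exact: Mplus_tridiagonal PB.1.
move=> i j ij e e0.
have [N _ HN] : \forall n \near \oo, n.+1%:R^-1 < e.
  exact: near_infty_natSinv_lt (PosNum e0).
apply: (@nat_ultrafilter_eventually (N + (absz i + absz j))) => n nN /=.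
rewrite normc_sub; apply: lt_trans (Hk n i j _ _ ij) (HN n _); rewrite /=; lia.
Qed.

End Pseudoergodic.

(** * Gluing two half-axes *)

Section Gluing.
Variable R : realType.
Implicit Types (B C D S M : nat -> nat -> R[i]) (U V W : set R[i]) (tau : R).

(** Site [k] of [D] sits at [Negz k], that is [-(k + 1)]. This reflection exchanges sub- and
    superdiagonal, hence the transpose in [zglue_zMplus]. In each constant block [zact] reads only
    the entry next to the junction. *)
Definition zglue (w u : R[i]) D B (i j : int) : R[i] :=
  match i, j with
  | Posz k, Posz l => B k l
  | Negz k, Negz l => D k l
  | Posz _, Negz _ => u
  | Negz _, Posz _ => w
  end.

Lemma zglue_tr w u D B :
  transpose (zglue w u D B) = zglue u w (transpose D) (transpose B).
Proof. by apply/funext => -[i|i]; apply/funext => -[j|j]. Qed.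

Lemma zact_zglue_Negz w u D B z k : tridiagonal D ->
  zact (zglue w u D B) z (Negz k) =
  tridiag_act D (z \o Negz) k + (k == 0%N)%:R * (w * z (Posz 0)).
Proof.
move=> tD; rewrite tridiag_actE// /zact.
have -> : Negz k - 1 = Negz k.+1 by lia.
case: k => [|k].
  by have -> : Negz 0 + 1 = Posz 0 by []; rewrite /=; ring.
have -> : Negz k.+1 + 1 = Negz k by lia.
by rewrite /=; ring.
Qed.

Lemma zact_zglue_Posz w u D B z k : tridiagonal B ->
  zact (zglue w u D B) z (Posz k) =
  tridiag_act B (z \o Posz) k + (k == 0%N)%:R * (u * z (Negz 0)).
Proof.
move=> tB; rewrite tridiag_actE// /zact.
have -> : Posz k + 1 = Posz k.+1 by lia.
case: k => [|k].
  by have -> : Posz 0 - 1 = Negz 0 by []; rewrite /=; ring.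
have -> : Posz k.+1 - 1 = Posz k by lia.
by rewrite /=; ring.
Qed.

Lemma zglue_zMplus U V W w u B C : U u -> W w ->
  Mplus U V W C -> Mplus U V W B -> zMplus U V W (zglue w u (transpose C) B).
Proof.
move=> Uu Ww MC MB [[|k]|k]; split.
- by have -> : Posz 0 - 1 = Negz 0 by [].
- exact: (Mplus_diag 0 MB).
- exact: (Mplus_sup 0 MB).
- have -> : Posz k.+1 - 1 = Posz k by lia.
  exact: (Mplus_sub k MB).
- exact: (Mplus_diag k.+1 MB).
- have -> : Posz k.+1 + 1 = Posz k.+2 by lia.
  exact: (Mplus_sup k.+1 MB).
- have -> : Negz k - 1 = Negz k.+1 by lia.
  exact: (Mplus_sub k MC).
- exact: (Mplus_diag k MC).
- case: k => [|k]; first by have -> : Negz 0 + 1 = Posz 0 by [].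
  have -> : Negz k.+1 + 1 = Negz k by lia.
  exact: (Mplus_sup k MC).
Qed.

(** A bounded sequence lies in l^oo, where a decaying inverse gives injectivity. *)
Lemma decaying_inverse_kernel B S tau x m : tridiagonal B -> entries_le B tau ->
  decaying_inverse B S -> (forall i, normc (x i) <= m) ->
  (forall i, tridiag_act B x i = 0) -> forall i, x i = 0.
Proof.
move=> tB Bt BS xm Bx i.
have m0 : 0 <= m by apply: le_trans (normc_ge0 _) (xm 0%N).
have hoo : (1%:E <= +oo :> \bar R)%E by rewrite leey.
have [_ [T [_ TB]]] := decaying_inverse_lp_invertible hoo tB Bt BS.
have bounded_lp y : (forall i, normc (y i) <= m) -> lp +oo y.
  by move=> ym; apply/lpP; exists m; apply/(lp_le_inftyP _ _ erefl).
have [<- _] := TB x (bounded_lp _ xm).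
have -> : tridiag_act B x = tridiag_act B (fun=> 0).
  apply/funext => k; rewrite Bx /tridiag_act big1// => j _.
  by rewrite mulr0.
by have [|-> _] := TB (fun=> 0) _; first by apply: bounded_lp => k; rewrite normc0.
Qed.

(* Eliminating the [B] block leaves the rank-one modification of [D] given by
   the Schur complement. *)
Lemma zglue_column w u D B S tau y m j : tridiagonal D -> tridiagonal B ->
  entries_le B tau -> decaying_inverse B S -> (forall i, normc (y i) <= m) ->
  (forall i, zact (zglue w u D B) y i = (i == Negz j)%:R) ->
  forall i, tridiag_act D (y \o Negz) i =
    (i == j)%:R + (i == 0%N)%:R * (w * u * S 0%N 0%N * y (Negz 0)).
Proof.
move=> tD tB Bt BS ym Ay i.
have [[K [r [K0 r0 r1 SK]]] BSI _] := BS.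
(* On the right half-axis [B y = - u y(-1) e_0]. Hence [v] is bounded and annihilated by [B], so it
   vanishes, and its entry at [0] expresses [y(0)] through [y(-1)]. *)
pose v k := u * y (Negz 0) * S k 0%N + y (Posz k).
have vm k : normc (v k) <= normc (u * y (Negz 0)) * K + m.
  apply: le_trans (normc_triangle _ _) _; apply: lerD => //.
  rewrite normcM; apply: ler_wpM2l; first exact: normc_ge0.
  apply: le_trans (SK _ _) _; rewrite -[leRHS]mulr1; apply: ler_wpM2l => //.
  by apply: exprn_ile1; exact: ltW.
have Bv k : tridiag_act B v k = 0.
  rewrite /v tridiag_act_linear BSI.
  have := Ay (Posz k); rewrite zact_zglue_Posz// (_ : (Posz k == Negz j) = false)// => yk.
  by rewrite -[RHS]yk; ring.
have := decaying_inverse_kernel tB Bt BS vm Bv 0%N; rewrite /v => /eqP.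
rewrite addrC addr_eq0 => /eqP y0.
have := Ay (Negz i); rewrite zact_zglue_Negz// y0 => /(canRL (addrK _)) ->.
have -> : (Negz i == Negz j) = (i == j) by [].
by ring.
Qed.

(** The Sherman-Morrison formula: the hypothesis says that [M] is a right inverse of
    [D - g e_0 e_0^T]. *)
Lemma rank_one_column D M (g : R[i]) :
  (forall i j, tridiag_act D (M^~ j) i =
     (i == j)%:R + (i == 0%N)%:R * (g * M 0%N j)) ->
  1 + g * M 0%N 0%N != 0 ->
  right_inverse_mx D (fun i j => M i j - g / (1 + g * M 0%N 0%N) * M i 0%N * M 0%N j).
Proof.
move=> DM nz i j; set c := g / _.
have -> : (fun k => M k j - c * M k 0%N * M 0%N j) =
    (fun k => (- (c * M 0%N j)) * M k 0%N + M k j).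
  by apply/funext => k; ring.
rewrite tridiag_act_linear !DM.
have -> : - (c * M 0%N j) * ((i == 0%N)%:R + (i == 0%N)%:R * (g * M 0%N 0%N)) =
   - (i == 0%N)%:R * M 0%N j * (c * (1 + g * M 0%N 0%N)) by ring.
by rewrite /c divfK//; ring.
Qed.

(** The correction decays like [r ^+ (i + j)], which is at most the power of [r] at the distance of
    [i] and [j]. *)
Lemma decaying_rank_one M (c : R[i]) K r : decaying M K r ->
  decaying (fun i j => M i j - c * M i 0%N * M 0%N j) (K + normc c * K * K) r.
Proof.
move=> [K0 r0 r1 MK]; split => //.
  by apply: addr_ge0 => //; rewrite !mulr_ge0 ?normc_ge0.
move=> i j; apply: le_trans (normc_triangle _ _) _; rewrite normcN mulrDl.
apply: lerD => //; rewrite !normcM.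
have -> : normc c * K * K * r ^+ `|i%:Z - j%:Z|%N =
  normc c * (K * (K * r ^+ `|i%:Z - j%:Z|%N)) by ring.
rewrite -mulrA; apply: ler_wpM2l; first exact: normc_ge0.
apply: (@le_trans _ _ ((K * r ^+ i) * (K * r ^+ j))).
  apply: ler_pM; rewrite ?normc_ge0//.
    by have := MK i 0%N; rewrite subr0.
  by have := MK 0%N j; rewrite sub0r abszN.
have -> : K * r ^+ i * (K * r ^+ j) = K * (K * r ^+ (i + j)) by rewrite exprD; ring.
do 2 apply: ler_wpM2l => //.
by apply: ler_wiXn2l; [exact: ltW|exact: ltW|lia].
Qed.

(** The added first site is the one where the glued vector vanishes in Coburn's argument. *)
Definition prepend (v w u : R[i]) C (i j : nat) : R[i] :=
  match i, j with
  | k.+1, l.+1 => C k l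
  | 0%N, 0%N => v
  | 0%N, 1%N => w
  | 1%N, 0%N => u
  | _, _ => 0
  end.

Lemma prepend_Mplus U V W v w u C : V v -> W w -> U u ->
  Mplus U V W C -> Mplus U V W (prepend v w u C).
Proof.
move=> Vv Ww Uu MC [|[|i]] [|[|j]]; rewrite /tridiag_entry //=.
- exact: (MC 0%N 0%N).
- exact: (MC 0%N j.+1).
- exact: (MC i.+1 0%N).
- exact: (MC i.+1 j.+1).
Qed.

Lemma tridiag_act_prepend v w u C x : tridiagonal C ->
  tridiag_act (prepend v w u C) x =
  (fun i => if i is k.+1
            then tridiag_act C (fun l => x l.+1) k + (k == 0%N)%:R * (u * x 0%N)
            else v * x 0%N + w * x 1%N).
Proof.
move=> tC; apply/funext => -[|i].
  by rewrite /tridiag_act !big_ord_recl big_ord0 addr0.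
rewrite /tridiag_act big_ord_recl/=; case: i => [|i].
  by rewrite mul1r addrC.
by rewrite !mul0r addr0 add0r.
Qed.

(* Coburn's argument: the vectors [x] and [y] are transplanted to the two sides
   of a site where the glued vector vanishes; the one remaining equation, at
   that site, is solved by scaling them. *)
Lemma zglue_coburn v w u C G tau m x y :
  let A := zglue w u (transpose C) (prepend v w u C) in
  tridiagonal C -> entries_le C tau ->
  (forall i j, normc (A i j) <= tau) -> zdecaying_inverse A G ->
  (forall i, normc (x i) <= m) -> (forall i, normc (y i) <= m) ->
  (forall i, tridiag_act (transpose C) x i = 0) ->
  (forall i, tridiag_act C y i = 0) -> x 0%N = y 0%N -> x 0%N = 0.
Proof.
move=> A tC Ct At AG xm ym Cx Cy xy0.
(* [a u + b w = 0] is the equation at the zero site, divided by the common value [x 0 = y 0]. The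
   pair [(w, - u)] solves it, unless both vanish and any pair does. *)
have [a [b [ab0 abuw]]] : exists a b : R[i], (a != 0) || (b != 0) /\ a * u + b * w = 0.
  have [u0|u0] := eqVneq u 0.
    have [w0|w0] := eqVneq w 0; last by exists w, 0; rewrite u0 w0 mulr0 mul0r addr0.
    by exists 1, 0; rewrite u0 w0 !mulr0 addr0 oner_neq0.
  by exists w, (- u); rewrite oppr_eq0 u0 orbT; split=> //; ring.
pose z (i : int) : R[i] := match i with
  | Negz k => a * x k | Posz k.+1 => b * y k | Posz 0 => 0 end.
have tC' := tridiagonal_tr tC.
have m0 : 0 <= m by apply: le_trans (normc_ge0 _) (xm 0%N).
have tP : tridiagonal (prepend v w u C).
  by move=> [|[|i]] [|[|j]]//= ij; apply: tC.
have zm i : normc (z i) <= (normc a + normc b) * m.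
  have am : 0 <= normc a * m by rewrite mulr_ge0 ?normc_ge0.
  have bm : 0 <= normc b * m by rewrite mulr_ge0 ?normc_ge0.
  rewrite mulrDl; case: i => [[|k]|k]; rewrite /z ?normc0 ?normcM; first exact: addr_ge0.
    have : normc b * normc (y k) <= normc b * m by apply: ler_wpM2l; rewrite ?normc_ge0.
    by lra.
  have : normc a * normc (x k) <= normc a * m by apply: ler_wpM2l; rewrite ?normc_ge0.
  by lra.
have scale D c s i : tridiag_act D (fun k => c * s k) i = c * tridiag_act D s i.
  by rewrite /tridiag_act mulr_sumr; apply: eq_bigr => j _; ring.
have Az i : zact A z i = 0.
  case: i => k.
    rewrite zact_zglue_Posz// tridiag_act_prepend//; case: k => [|k] /=.
      rewrite -xy0 mul1r mulr0 add0r -[RHS](mul0r (x 0%N)) -abuw.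
      by ring.
    by rewrite (scale C b y) Cy; ring.
  by rewrite zact_zglue_Negz// (scale (transpose C) a x) Cx !mulr0 addr0.
have z0 := zdecaying_inverse_kernel AG At zm Az.
(* The vanishing of [z] is read off next to the zero site, on a side whose scale is nonzero. *)
case/orP: ab0 => [a0|b0].
  by have /eqP := z0 (Negz 0); rewrite mulf_eq0 (negbTE a0) => /eqP.
by have /eqP := z0 (Posz 1); rewrite mulf_eq0 (negbTE b0) xy0 => /eqP.
Qed.

Lemma PsiEplus_Mplus_inverse U V W tau B C S :
  bounded_entries U V W tau ->
  PsiEplus U V W B -> decaying_inverse B S -> Mplus U V W C ->
  exists S', decaying_inverse C S'.
Proof.
move=> UVWt PB BS MC; have MB := PB.1.
have Mle X := @Mplus_entries_le R U V W tau X UVWt.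
have tB := Mplus_tridiagonal MB; have tC := Mplus_tridiagonal MC.
have tC' := tridiagonal_tr tC; have tB' := tridiagonal_tr tB.
(* Any elements of the three sets would do; [B] supplies some. *)
pose u := B 1%N 0%N; pose v := B 0%N 0%N; pose w := B 0%N 1%N.
have Uu : U u := Mplus_sub 0 MB; have Vv : V v := Mplus_diag 0 MB.
have Ww : W w := Mplus_sup 0 MB.
have [G AG] := PsiEplus_zinverse PB BS (zglue_zMplus Uu Ww MC MB).
have [[K [r [K0 r0 r1 GK]]] AGI GAI] := AG.
have GK' i j : normc (G i j) <= K.
  apply: le_trans (GK _ _) _; rewrite -[leRHS]mulr1; apply: ler_wpM2l => //.
  by apply: exprn_ile1; exact: ltW.
pose M i j := G (Negz i) (Negz j).
pose g := w * u * S 0%N 0%N.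
have MK : decaying M K r.
  split=> // i j; apply: le_trans (GK _ _) _.
  by have -> : absz (Negz i - Negz j) = absz (i%:Z - j%:Z) by lia.
have DM i j : tridiag_act (transpose C) (M^~ j) i =
    (i == j)%:R + (i == 0%N)%:R * (g * M 0%N j).
  exact: (zglue_column tC' tB (Mle _ MB) BS (fun k => GK' k (Negz j))
    (fun k => AGI k (Negz j)) i).
(* Row [Negz i] of [G] is a column of the inverse of the transposed glued matrix, whose left block
   is [C]. *)
have MD i j : tridiag_act C (M i) j = (j == i)%:R + (j == 0%N)%:R * (g * M i 0%N).
  have GA k : zact (zglue u w C (transpose B)) (G (Negz i)) k = (k == Negz i)%:R.
    by rewrite eq_sym -GAI zglue_tr.
  have Bt' : entries_le (transpose B) tau by move=> k l; exact: (Mle _ MB).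
  have := zglue_column tC tB' Bt' (decaying_inverse_tr BS) (GK' (Negz i)) GA j.
  by rewrite (mulrC u w).
have [g0|g0] := eqVneq (1 + g * M 0%N 0%N) 0; last first.
  pose c := g / (1 + g * M 0%N 0%N).
  exists (transpose (fun i j => M i j - c * M i 0%N * M 0%N j)).
  have DR := rank_one_column DM g0.
  (* The formula for [C] and the one for its transpose produce the same matrix up to transposition,
     hence a two-sided inverse. *)
  have MR : right_inverse_mx C (transpose (fun i j => M i j - c * M i 0%N * M 0%N j)).
    move=> i j; have := @rank_one_column C (transpose M) g (fun i j => MD j i) g0 i j.
    move=> <-; congr (tridiag_act _ _ _); apply/funext => k.
    by rewrite /transpose /c; ring.
  split=> //; exists (K + normc c * K * K), r.
  exact/decaying_tr/decaying_rank_one.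
(* Degenerate case: column [0] and row [0] of [M] are null vectors of [C^T] and [C] with the common
   first entry [M 0 0]. Coburn's argument makes it zero, so [1 + g * M 0 0] equals [1], not [0]. *)
pose A2 := zglue w u (transpose C) (prepend v w u C).
have MP : Mplus U V W (prepend v w u C) by exact: prepend_Mplus.
have [G2 AG2] := PsiEplus_zinverse PB BS (zglue_zMplus Uu Ww MC MP).
have A2t i j : normc (A2 i j) <= tau.
  case: i => i; case: j => j; rewrite /A2 /=.
  - exact: (Mle _ MP).
  - by apply: UVWt; left.
  - by apply: UVWt; right; right.
  - exact: (Mle _ MC).
have M00 : M 0%N 0%N = 0.
  apply: (zglue_coburn tC (Mle _ MC) A2t AG2
    (fun i => GK' (Negz i) (Negz 0)) (fun i => GK' (Negz 0) (Negz i))) => // i.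
    by have := DM i 0%N; rewrite -[X in X + _]mulr1 -mulrDr g0 mulr0.
  by have := MD 0%N i; rewrite -[X in X + _]mulr1 -mulrDr g0 mulr0.
by move/eqP: g0; rewrite M00 mulr0 addr0 oner_eq0.
Qed.

End Gluing.

(** * Spectra *)

Section Spectrum.
Variable R : realType.
Implicit Types (A B C : nat -> nat -> R[i]) (U V W : set R[i]) (z : R[i]).

(** In an unbounded set one could pick [a n] of modulus above [n]; such a sequence has no cluster
    point. *)
Lemma compact_normc_bounded (U : set R[i]) : compact (U : set R[i]^o) ->
  exists tau, forall a, U a -> normc a <= tau.
Proof.
move=> cU; apply: contrapT => H.
have /choice [a Ha] : forall n : nat, exists a, U a /\ n%:R < normc a.
  move=> n; apply: contrapT => Hn; apply: H; exists n%:R => a Ua.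
  by rewrite leNgt; apply/negP => na; apply: Hn; exists a.
have [|b [_ ab]] := cU (a @ nat_ultrafilter) _.
  by apply: (@nat_ultrafilter_eventually 0) => n _; exact: (Ha n).1.
have nb : nbhs (b : R[i]^o) (ball (b : R[i]^o) 1) by exact: nbhsx_ballx.
pose N := (Num.truncn (normc b + 1)).+1.
have Na : (a @ nat_ultrafilter) (a @` [set n | (N <= n)%N]).
  by apply: (@nat_ultrafilter_eventually N) => n Nn; exists n.
have [_ [[n /= Nn <-]]] := ab _ _ Na nb.
rewrite -ball_normE /= => /normc_lt bn.
have := normc_triangle (a n - b) b; rewrite subrK normc_sub => tri.
have := (Ha n).2; have : normc b + 1 < N%:R by exact: truncnS_gt.
have : N%:R <= n%:R :> R by rewrite ler_nat.
by lra.
Qed.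

(** The exponent [p] enters only in passing to a decaying inverse of [B] and back from one of
    [C]. *)
Lemma PsiEplus_invertible (p : \bar R) U V W tau B : (1%:E <= p)%E ->
  bounded_entries U V W tau -> PsiEplus U V W B ->
  lp_invertible p (tridiag_act B) <->
  forall C, Mplus U V W C -> lp_invertible p (tridiag_act C).
Proof.
move=> hp UVWt PB; split=> [iB C MC|]; last by apply; exact: PB.1.
have Bt := Mplus_entries_le UVWt PB.1.
have [S BS] := lp_invertible_decaying_inverse hp (Mplus_tridiagonal PB.1) Bt iB.
have [S' CS'] := PsiEplus_Mplus_inverse UVWt PB BS MC.
apply: decaying_inverse_lp_invertible CS' => //.
- exact: Mplus_tridiagonal MC.
- exact: Mplus_entries_le UVWt MC.
Qed.

(** The matrix [A - z I]. It belongs to the class with [V] translated to [V - z], written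
    [[set v | V (v + z)]], which reduces spectra to invertibility. *)
Definition shift_diag z A (i j : nat) := A i j - (i == j)%:R * z.

Lemma tridiag_act_shift z A x :
  tridiag_act (shift_diag z A) x = (fun n => tridiag_act A x n - z * x n).
Proof.
apply/funext => n; rewrite /tridiag_act /shift_diag.
have -> : z * x n = \sum_(j < n.+2) (n == j)%:R * z * x j.
  rewrite (bigD1 (Ordinal (leqnSn n.+1)))//= eqxx mul1r big1 ?addr0// => j.
  by rewrite -val_eqE/= eq_sym => /negbTE ->; rewrite !mul0r.
by rewrite -sumrB; apply: eq_bigr => j _; rewrite mulrBl.
Qed.

Lemma tridiag_entry_shift z U V W i j a :
  tridiag_entry U [set v | V (v + z)] W i j (a - (i == j)%:R * z) <->
  tridiag_entry U V W i j a.
Proof.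
rewrite /tridiag_entry; have [->|ij] := eqVneq i j.
  have -> : (j == j.+1) = false by lia.
  by rewrite /= mul1r subrK.
by rewrite mul0r subr0.
Qed.

Lemma Mplus_shift z U V W A :
  Mplus U [set v | V (v + z)] W (shift_diag z A) <-> Mplus U V W A.
Proof.
by split=> MA i j; apply/(tridiag_entry_shift z); [exact: MA|have := MA i j].
Qed.

Lemma shift_diagK z A : shift_diag z (shift_diag (- z) A) = A.
Proof.
by apply/funext => i; apply/funext => j; rewrite /shift_diag; ring.
Qed.

Lemma PsiEplus_shift z U V W B : PsiEplus U V W B ->
  PsiEplus U [set v | V (v + z)] W (shift_diag z B).
Proof.
move=> [MB PB]; split; first exact/Mplus_shift.
move=> n F e n0 MF e0.
(* Adding [z I] moves the target [F] back to the original class and leaves its difference from the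
   block unchanged. *)
have [|k Hk] := PB n (F + z%:M) e n0 _ e0.
  move=> i j; rewrite !mxE.
  have MFij := MF i j; rewrite -[F i j](addrK (((i : nat) == j)%:R * z)) in MFij.
  by move/tridiag_entry_shift: MFij; rewrite mulr_natl.
exists k; apply: le_lt_trans Hk; rewrite le_eqVlt; apply/orP; left; apply/eqP.
congr (`| _ |); apply/matrixP => i j; rewrite !mxE /shift_diag eqn_add2l.
by rewrite -mulr_natl; ring.
Qed.

Lemma bounded_entries_shift z U V W tau : bounded_entries U V W tau ->
  bounded_entries U [set v | V (v + z)] W (tau + normc z).
Proof.
move=> UVWt a [Ua|[/= Va|Wa]].
- by apply: ler_wpDr; [exact: normc_ge0|apply: UVWt; left].
- have := normc_triangle (a + z) (- z); rewrite addrK normcN => /le_trans; apply.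
  by rewrite lerD2r; apply: UVWt; right; left.
- by apply: ler_wpDr; [exact: normc_ge0|apply: UVWt; right; right].
Qed.

End Spectrum.

Theorem corollary2p5 (R : realType) (p : \bar R) (hp : (1%:E <= p)%E)
    (U V W : set R[i])
    (hU0 : U !=set0) (hV0 : V !=set0) (hW0 : W !=set0)
    (hU : compact (U : set R[i]^o)) (hV : compact (V : set R[i]^o))
    (hW : compact (W : set R[i]^o)) :
  forall B : nat -> nat -> R[i], PsiEplus U V W B ->
    (lp_invertible p (tridiag_act B) <->
       forall C : nat -> nat -> R[i], Mplus U V W C ->
         lp_invertible p (tridiag_act C)) /\
    lp_spec p (tridiag_act B) =
      \bigcup_(C in Mplus U V W) lp_spec p (tridiag_act C).
Proof.
move=> B PB.
have [tU Ut] := compact_normc_bounded hU.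
have [tV Vt] := compact_normc_bounded hV.
have [tW Wt] := compact_normc_bounded hW.
have UVW : bounded_entries U V W (Num.max tU (Num.max tV tW)).
  by move=> a; rewrite !le_max; case=> [/Ut|[/Vt|/Wt]] ->; rewrite ?orbT.
split; first exact: PsiEplus_invertible UVW PB.
have shiftE z A : lp_invertible p (fun x n => tridiag_act A x n - z * x n) =
    lp_invertible p (tridiag_act (shift_diag z A)).
  by congr lp_invertible; apply/funext => x; rewrite tridiag_act_shift.
have inv_shift z := PsiEplus_invertible hp
  (bounded_entries_shift (z := z) UVW) (PsiEplus_shift z PB).
apply/seteqP; split=> z; rewrite /lp_spec /= shiftE.
  rewrite inv_shift => /existsNP[C /not_implyP[MC nC]].
  (* The non-invertible [C] lies in the translated class; undoing the translation gives the required
     member of the original class. *)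
  rewrite -(shift_diagK z C) in MC nC.
  by exists (shift_diag (- z) C) => /=; [exact/(Mplus_shift z)|rewrite shiftE].
move=> [C MC /= + iB]; rewrite shiftE; apply.
by move/inv_shift: iB; apply; exact/Mplus_shift.
Qed.
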